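(* Consider the combined direct/indirect adaptive system (CMRAC-C) $$\dot x=A_px+bu,\qquad \dot x_m=A_mx_m+br+\ell(x-x_m),\qquad u=\theta^Tx+r,$$ $$\dot x_i=-(\sigma+\ell)(x_i-x)+(A_m-b\hat\theta^T)x+bu,\qquad e_m=x-x_m,\quad e_i=x_i-x,$$ $$\dot\theta=\mathrm{Proj}_\Gamma(\theta,-xe_m^TP_mb,f)-\eta(\theta-\hat\theta),\qquad \dot{\hat\theta}=\mathrm{Proj}_\Gamma(\hat\theta,xe_i^TP_ib,f)+\eta(\theta-\hat\theta),$$ with all objects as in the context (in particular $A_m=A_p+b\theta^{*T}$ and $\|\theta^*\|\le\theta^*_{max}$). For any initial conditions $e_m(0),e_i(0)\in\mathbb R^n$ and $\theta(0),\hat\theta(0)$ with $\|\theta(0)\|\le\theta_{\max}$, $\|\hat\theta(0)\|\le\theta_{\max}$, the signals $e_m(t),e_i(t),\theta(t),\hat\theta(t)$ are uniformly bounded for all $t\ge0$; the function $$V=e_m^TP_me_m+e_i^TP_ie_i+\tilde\theta^T\Gamma^{-1}\tilde\theta+\bar\theta^T\Gamma^{-1}\bar\theta,\qquad\tilde\theta=\theta-\theta^*,\ \bar\theta=\hat\theta-\theta^*,$$ satisfies along trajectories $$\dot V\le-\alpha_1V+2\alpha_2,\qquad\alpha_1=\frac{\sigma+2\ell}{m^2},\quad\alpha_2=\frac{\sigma+2\ell}{m^2\gamma}\tilde\theta_{\max}^2,$$ and $(e_m,e_i,\tilde\theta,\bar\theta)$ converges exponentially to the set $$\mathcal E=\left\{(e_m,e_i,\tilde\theta,\bar\theta):\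 \|e_m\|^2\le\beta_4\tilde\theta_{\max}^2,\ \|e_i\|^2\le\beta_5\tilde\theta_{\max}^2,\ \|\tilde\theta\|\le\tilde\theta_{\max},\ \|\bar\theta\|\le\tilde\theta_{\max}\right\},$$ where $\beta_4=\dfrac{4(s+\ell)}\gamma$ and $\beta_5=\dfrac{4(\sigma+\ell)}\gamma$.
   Context: $\|\cdot\|$ is the Euclidean norm (induced norm for matrices). $A_p\in\mathbb R^{n\times n}$, $b\in\mathbb R^n$, $A_m\in\mathbb R^{n\times n}$ is Hurwitz, $r:[0,\infty)\to\mathbb R$ is bounded, $\ell\ge0$, $\gamma>0$, $\eta>0$, $\Gamma=\gamma I_{n\times n}$. $\theta^*\in\mathbb R^n$ satisfies $A_m=A_p+b\theta^{*T}$ and $\|\theta^*\|\le\theta^*_{max}$, with $\theta^*_{max}>0$ known. $P_m=P_m^T>0$ solves $\bar A_m^TP_m+P_m\bar A_m=-I_{n\times n}$ with $\bar A_m=A_m-\ell I_{n\times n}$, and $P_i=\frac1{2(\sigma+\ell)}I_{n\times n}$. Constants: $\sigma=-\max_i\mathrm{Re}\,\lambda_i(A_m)$, $s=-\min_i\lambda_i\big((A_m+A_m^T)/2\big)$, $a=\|A_m\|$, $m=(1+4a/\sigma)^{n-1}$. Projection: with $\vartheta=\theta^*_{max}$ and a design constant $\varepsilon>0$, $f(\theta)=\dfrac{\|\theta\|^2-\vartheta^2}{2\varepsilon\vartheta+\varepsilon^2}$, $\theta_{\max}=\vartheta+\varepsilon$, $\tilde\theta_{\max}=2\vartheta+\varepsilon$,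 and $$\mathrm{Proj}_\Gamma(\theta,y,f)=\begin{cases}\Gamma y-\Gamma\dfrac{\nabla f(\theta)\nabla f(\theta)^T}{\nabla f(\theta)^T\Gamma\nabla f(\theta)}\Gamma y\,f(\theta)&\text{if }f(\theta)>0\text{ and }y^T\Gamma\nabla f(\theta)>0,\\ \Gamma y&\text{otherwise.}\end{cases}$$ *)

(* Defs.v *)
From mathcomp Require Import all_boot all_order all_algebra.
From mathcomp Require Import complex.
From mathcomp Require Import all_classical all_reals all_analysis.

Set Implicit Arguments.
Unset Strict Implicit.
Unset Printing Implicit Defensive.

Import Order.TTheory GRing.Theory Num.Theory.
Import numFieldNormedType.Exports.

Local Open Scope classical_set_scope.
Local Open Scope ring_scope.

Section LinearAlgebra.
Variables (R : realType) (n : nat).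
Implicit Types (A P : 'M[R]_n) (u v : 'cV[R]_n).

Definition dot u v : R := (u^T *m v) 0 0.

(* The library norm [`|u|] on matrices is the max norm, not the Euclidean one. *)
Definition enorm u : R := Num.sqrt (\sum_i u i 0 ^+ 2).

Definition opnorm A : R :=
  sup [set enorm (A *m v) | v in [set v | enorm v <= 1]].

Definition qform P u : R := (u^T *m P *m u) 0 0.

Definition posdef P : Prop := P^T = P /\ forall u, u != 0 -> 0 < qform P u.

Definition ceigenvalue A (z : R[i]) : bool :=
  eigenvalue (map_mx (real_complex R) A) z.

Definition hurwitz A : Prop := forall z, ceigenvalue A z -> complex.Re z < 0.

(* [sup] and [inf] below are over finite sets, nonempty when [0 < n], so they
   are the maximum and the minimum. *)
Definition spectral_abscissa A : R :=
  sup [set complex.Re z | z in [set z | ceigenvalue A z]].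

(* A symmetric matrix has only real eigenvalues. *)
Definition min_sym_eigenvalue A : R :=
  inf [set z : R | eigenvalue (2^-1 *: (A + A^T)) z].

End LinearAlgebra.

Section Projection.
Variables (R : realType) (n : nat).

Definition gradient (f : 'cV[R]_n -> R) (p : 'cV[R]_n) : 'cV[R]_n :=
  \col_i derive f p (delta_mx i 0).

Definition proj_fun (vth eps : R) (p : 'cV[R]_n) : R :=
  (enorm p ^+ 2 - vth ^+ 2) / (2 * eps * vth + eps ^+ 2).

Definition Proj (G : 'M[R]_n) (p y : 'cV[R]_n) (f : 'cV[R]_n -> R) : 'cV[R]_n :=
  let g := gradient f p in
  if (0 < f p) && (0 < dot y (G *m g)) then
    G *m y - f p *: (G *m ((dot g (G *m g))^-1 *: (g *m g^T)) *m G *m y)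
  else G *m y.

End Projection.

Section Solutions.
Variables (R : realType) (n : nat).
Implicit Types (z : R -> 'cV[R]_n).

Definition abs_continuous_on (a b : R) z : Prop :=
  forall eps : R, 0 < eps -> exists2 delta : R, 0 < delta &
    forall (k : nat) (u v : 'I_k -> R),
      (forall i, a <= u i /\ u i <= v i /\ v i <= b) ->
      trivIset setT (fun i => [set` `]u i, v i[]) ->
      \sum_i (v i - u i) < delta ->
      \sum_i enorm (z (v i) - z (u i)) < eps.

(* Caratheodory solution of z' = F on [0, T[, with T possibly +oo: since the
   reference input is only assumed bounded, z' = F is required almost
   everywhere, for a locally absolutely continuous z. *)
Definition ode_solution (T : \bar R) z (F : R -> 'cV[R]_n) : Prop :=
  (forall t : R, 0 <= t -> (t%:E < T)%E -> abs_continuous_on 0 t z) /\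
  {ae @lebesgue_measure R, forall t : R,
     0 <= t -> (t%:E < T)%E -> is_derive t (1 : R) z (F t)}.

End Solutions.

Definition cmrac_c_solution (R : realType) (n : nat)
    (Ap Am Pm Pi Gam : 'M[R]_n) (b : 'cV[R]_n) (r : R -> R)
    (l sigma eta : R) (f : 'cV[R]_n -> R) (T : \bar R)
    (x xm xi th thh : R -> 'cV[R]_n) : Prop :=
  let u t := dot (th t) (x t) + r t in
  let em t := x t - xm t in
  let ei t := xi t - x t in
  [/\ ode_solution T x (fun t => Ap *m x t + u t *: b),
      ode_solution T xm (fun t => Am *m xm t + r t *: b + l *: (x t - xm t)),
      ode_solution T xi (fun t => - (sigma + l) *: (xi t - x t)
        + (Am - b *m (thh t)^T) *m x t + u t *: b),
      ode_solution T th (fun t =>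
        Proj Gam (th t) (- (x t *m ((em t)^T *m Pm *m b))) f
        - eta *: (th t - thh t)) &
      ode_solution T thh (fun t =>
        Proj Gam (thh t) (x t *m ((ei t)^T *m Pi *m b)) f
        + eta *: (th t - thh t))].

Section ErrorSpace.
Variables (R : realType) (n : nat).

(* (e_m, e_i, theta - theta^*, hat theta - theta^* ) in R^(4n) *)
Definition errors : Type := ('cV[R]_n * 'cV[R]_n * 'cV[R]_n * 'cV[R]_n)%type.

Definition errors_dist (z w : errors) : R :=
  let: (z1, z2, z3, z4) := z in
  let: (w1, w2, w3, w4) := w in
  Num.sqrt (enorm (z1 - w1) ^+ 2 + enorm (z2 - w2) ^+ 2
          + enorm (z3 - w3) ^+ 2 + enorm (z4 - w4) ^+ 2).

Definition errors_set_dist (z : errors) (E : set errors) : R :=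
  inf [set errors_dist z w | w in E].

Definition lyapunov (Pm Pi Gam : 'M[R]_n) (z : errors) : R :=
  let: (em, ei, tth, bth) := z in
  qform Pm em + qform Pi ei + qform (invmx Gam) tth + qform (invmx Gam) bth.

Definition attracting_set (beta4 beta5 tthmax : R) : set errors :=
  [set z | let: (em, ei, tth, bth) := z in
    [/\ enorm em ^+ 2 <= beta4 * tthmax ^+ 2,
        enorm ei ^+ 2 <= beta5 * tthmax ^+ 2,
        enorm tth <= tthmax & enorm bth <= tthmax]].

End ErrorSpace.

(* Main.v *)
Require Import Defs.
From mathcomp Require Import all_boot all_order all_algebra.
From mathcomp Require Import complex.
From mathcomp Require Import all_classical all_reals all_analysis.
From mathcomp Require Import measurable_realfun.
From mathcomp Require Import ring lra.

Set Implicit Arguments.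
Unset Strict Implicit.
Unset Printing Implicit Defensive.

Import Order.TTheory GRing.Theory Num.Theory.
Import numFieldNormedType.Exports.

Local Open Scope classical_set_scope.
Local Open Scope ring_scope.

(** Comparing [Pm] with [U^* D^2 U] / (sigma + 2 l), where [Am = U^* T U] is a
    Schur decomposition and [D] is diagonal with the powers of
    [rho = 1 + 4 a / sigma], gives [Pm <= m^2 / (sigma + 2 l)]; the eigenvector
    of [Pm] for its least eigenvalue gives [Pm >= 1 / (2 (s + l))].

    The reference input cancels in the error equations, so their right-hand
    sides are continuous along a solution; an absolutely continuous function
    whose derivative agrees almost everywhere with a continuous function is
    differentiable everywhere. The projection then keeps [th] and [thh] in the
    ball of radius [thmax], since the coupling term cannot increase the larger
    of the two norms, and [V' <= - |em|^2 - |ei|^2]. The bounds on [Pm] turn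
    this into a linear differential inequality for [V], whose integrated form
    bounds [em] and [ei], hence the distance to the attracting set. *)

(** The factor [m ^+ 2] is the price of making the Schur form nearly diagonal: conjugation by powers
    of [rho] damps the entries below the diagonal, and [rho - 1 = 4 a / sigma] is the value for
    which they contribute at most [sigma / 4] to the quadratic form, which the real parts of the
    eigenvalues can absorb. The claim on the derivative of [V] at every positive time is delicate
    because [x] itself need not be differentiable everywhere: [r] is an arbitrary bounded function.
    The error fields involve [x] only through its values, which are continuous in time. The passage
    from almost every time to every time is a mean value inequality, proved by a supremum argument
    along the interval rather than by integration. The parameter terms of [V] are not dissipated.
    They are only bounded, by [tthmax ^+ 2 / gam] each, and these two constants are the origin of
    [2 * alpha2]; multiplied by [2 (s + l)] and [2 (sigma + l)], the inverses of the lower bounds on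
    the two weight matrices, they give the factor [4] in [beta4] and [beta5]. *)

(** * Hermitian forms, the Rayleigh bound and geometric sums *)

Section HermitianForms.
Variable C : numClosedFieldType.
Local Open Scope sesquilinear_scope.

Definition hform n (M : 'M[C]_n) (y : 'rV[C]_n) : C := (y *m M *m y^t*) 0 0.

Lemma hform1E n (y : 'rV[C]_n) : hform 1%:M y = \sum_i `|y 0 i| ^+ 2.
Proof.
rewrite /hform mulmx1 mxE; apply: eq_bigr => i _.
by rewrite !mxE normCK.
Qed.

Lemma hform1_ge0 n (y : 'rV[C]_n) : 0 <= hform 1%:M y.
Proof. by rewrite hform1E sumr_ge0// => i _; rewrite exprn_ge0. Qed.

Lemma hform1_gt0 n (y : 'rV[C]_n) : y != 0 -> 0 < hform 1%:M y.
Proof.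
move=> y0; rewrite lt_def hform1_ge0 andbT hform1E; apply: contra y0.
rewrite psumr_eq0 => [|i _]; last by rewrite exprn_ge0.
move=> /allP y0; apply/eqP/rowP => i; rewrite mxE; apply/eqP.
by have := y0 i (mem_index_enum i); rewrite sqrf_eq0 normr_eq0.
Qed.

Lemma hform_conj n (B M : 'M[C]_n) (y : 'rV[C]_n) :
  hform (B *m M *m B^t*) y = hform M (y *m B).
Proof. by rewrite /hform trmx_mul map_mxM !mulmxA. Qed.

Lemma hformD n (M N : 'M[C]_n) y : hform (M + N) y = hform M y + hform N y.
Proof. by rewrite /hform mulmxDr mulmxDl mxE. Qed.

Lemma hformN n (M : 'M[C]_n) y : hform (- M) y = - hform M y.
Proof. by rewrite /hform mulmxN mulNmx mxE. Qed.

Lemma hform_adjoint n (M : 'M[C]_n) y : hform (M^t*) y = (hform M y)^*.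
Proof.
have -> : hform (M^t*) y = (map_mx Num.conj (y *m M *m y^t*)^T) 0 0.
  by rewrite /hform !trmx_mul !map_mxM trmxCK mulmxA.
by rewrite [LHS]mxE; congr (_^*); rewrite [LHS]mxE.
Qed.

Lemma hform_diag n (d : 'rV[C]_n) y :
  hform (diag_mx d) y = \sum_i d 0 i * `|y 0 i| ^+ 2.
Proof.
rewrite /hform mul_mx_diag mxE; apply: eq_bigr => i _.
by rewrite !mxE normCK mulrAC mulrC.
Qed.

Lemma hform_unitary n (V : 'M[C]_n) y :
  V \is unitarymx -> hform 1%:M (y *m V) = hform 1%:M y.
Proof.
by move=> /unitarymxP VV; rewrite -hform_conj mulmx1 VV.
Qed.

(** In the spectral basis the form is a sum of squared moduli weighted by eigenvalues, and the rows
    of [spectralmx M] are eigenvectors. A bound on a whole form is thereby reduced to a test on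
    eigenvectors. *)
Lemma rayleigh n (M : 'M[C]_n) (c : C) : M^t* = M ->
  (forall mu (w : 'rV_n), w != 0 -> w *m M = mu *: w -> mu <= c) ->
  forall y, hform M y <= c * hform 1%:M y.
Proof.
move=> Mherm Mc y.
have Mn : M \is normalmx by apply/normalmxP; rewrite Mherm.
have Vu := spectral_unitarymx M.
have /orthomx_spectralP ME := Mn.
move: Vu ME; set V := spectralmx M; set d := spectral_diag M => Vu ME.
have Vi := unitarymx_unit Vu.
have dc i : d 0 i <= c.
  apply: (Mc _ (row i V)).
    apply/eqP => V0; have := congr1 (mulmx^~ (invmx V)) V0.
    rewrite -row_mul mulmxV// mul0mx => /rowP/(_ i)/eqP.
    by rewrite !mxE eqxx oner_eq0.
  rewrite -row_mul {1}ME !mulmxA mulmxV// mul1mx.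
  by apply/rowP => j; rewrite mxE mul_diag_mx !mxE.
have Vt : V^t* \is unitarymx by rewrite trmxC_unitary.
rewrite -(hform_unitary y Vt).
rewrite ME invmx_unitary// -{2}(trmxCK V) hform_conj hform_diag hform1E mulr_sumr.
by apply: ler_sum => i _; apply: ler_wpM2r; rewrite ?exprn_ge0.
Qed.

(** With [geometric_sum_right], this gives the row and column sums of the weights below the
    diagonal. The factor [rho - 1] is not divided out, so that [rho = 1] is allowed. *)
Lemma geometric_sum_left (rho : C) i : rho != 0 ->
  (rho - 1) * \sum_(j < i) rho ^- (i - j) = 1 - rho ^- i.
Proof.
move=> r0; elim: i => [|i IH]; first by rewrite big_ord0 expr0 invr1 subrr mulr0.
have -> : \sum_(j < i.+1) rho ^- (i.+1 - j) =
  rho^-1 * (\sum_(j < i) rho ^- (i - j) + 1).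
  rewrite big_ord_recr/= subSnn expr1 mulrDr mulr1 mulr_sumr; congr (_ + _).
  by apply: eq_bigr => j _; rewrite subSn 1?ltnW// exprS invfM.
rewrite mulrCA mulrDr IH exprS invfM; field.
by rewrite expf_neq0.
Qed.

Lemma geometric_sum_right (rho : C) n j : rho != 0 ->
  (rho - 1) * \sum_(i < n | (j < i)%N) rho ^- (i - j) = 1 - rho ^- (n.-1 - j).
Proof.
move=> r0; elim: n => [|n IH]; first by rewrite big_ord0 expr0 invr1 subrr mulr0.
rewrite big_mkcond big_ord_recr/= -big_mkcond mulrDr IH.
case: ltnP => jn; last first.
  (* For [n <= j] both truncated differences are [0]. *)
  rewrite mulr0 addr0; congr (_ - _ ^- _).
  by apply/eqP; rewrite eq_sym; move: jn; rewrite -subn_eq0 => /eqP jn; rewrite jn -subn1 subnAC jn.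
have -> : (n - j = (n.-1 - j).+1)%N by case: n jn {IH} => // n jn; rewrite subSn.
by rewrite exprS invfM; field; rewrite expf_neq0.
Qed.
End HermitianForms.

(** * Upper bound on a solution of the Lyapunov equation, over the complex numbers *)

Section LyapunovUpperBound.
Variable C : numClosedFieldType.
Local Open Scope sesquilinear_scope.

(** The entries are values of the sesquilinear form of [A] on pairs of rows of [U], which are unit
    vectors. *)
Lemma unitary_coef_bound n (A U : 'M[C]_n) a :
  (forall x y : 'rV[C]_n, hform 1%:M x = 1 -> hform 1%:M y = 1 ->
    `|(x *m A *m y^t*) 0 0| <= a) ->
  U \is unitarymx -> forall i j, `|(U *m A *m U^t*) i j| <= a.
Proof.
move=> Aa /unitarymxP UU i j.
have e1 k : hform 1%:M (row k U) = 1.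
  transitivity ((1%:M : 'M[C]_n) k k); last by rewrite mxE eqxx.
  by rewrite /hform mulmx1 -UU !mxE; apply: eq_bigr => i0 _; rewrite !mxE.
have -> : (U *m A *m U^t*) i j = (row i U *m A *m (row j U)^t*) 0 0.
  rewrite -row_mul !mxE; apply: eq_bigr => k _.
  by rewrite !mxE.
exact: Aa.
Qed.

(** The inequality [2 p q <= p^2 + q^2] splits each term into a half controlled by a row sum of the
    weights and a half controlled by a column sum. The relation [a * 4 = sg * (rho - 1)] makes [a]
    times either geometric sum at most [sg / 4]. *)
Lemma weighted_cross_terms n (T : 'M[C]_n) (a sg rho : C) (w : 'rV[C]_n) :
  1 <= rho -> 0 <= a -> a * 4 = sg * (rho - 1) -> 0 <= sg ->
  (forall i j, `|T i j| <= a) ->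
  \sum_(i < n) \sum_(j < n | (j < i)%N) `|w 0 i * (T i j * rho ^- (i - j)) * (w 0 j)^*|
    <= sg / 4 * hform 1%:M w.
Proof.
move=> r1 a0 arho sg0 Ta.
have r0 : 0 < rho by rewrite (lt_le_trans ltr01).
have sgsum x N : 0 <= x -> (rho - 1) * x = 1 - rho ^- N -> a * x <= sg / 4.
  move=> x0 xE; rewrite -(ler_pM2r (x := 4)) ?ltr0n// mulfVK ?pnatr_eq0//.
  rewrite mulrAC arho -mulrA xE -[leRHS]mulr1 ler_wpM2l//.
  by rewrite gerBl invr_ge0 exprn_ge0 ?ltW.
have pow0 i j : 0 <= rho ^- (i - j) by rewrite invr_ge0 exprn_ge0 ?ltW.
have rn0 : rho != 0 by rewrite gt_eqF.
have step i j : `|w 0 i * (T i j * rho ^- (i - j)) * (w 0 j)^*| <=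
   a * rho ^- (i - j) * (`|w 0 i| ^+ 2 / 2) + a * rho ^- (i - j) * (`|w 0 j| ^+ 2 / 2).
  rewrite -mulrDr !normrM norm_conjC (ger0_norm (pow0 i j)).
  rewrite mulrAC mulrC ler_pM ?mulr_ge0 ?ler_wpM2r//.
  rewrite -mulrDl ler_pdivlMr ?ltr0n// -subr_ge0.
  have -> : `|w 0 i| ^+ 2 + `|w 0 j| ^+ 2 - `|w 0 i| * `|w 0 j| * 2 =
    (`|w 0 i| - `|w 0 j|) ^+ 2 by ring.
  by rewrite -realEsqr rpredB ?normr_real.
apply: le_trans (_ : \sum_(i < n) \sum_(j < n | (j < i)%N)
   (a * rho ^- (i - j) * (`|w 0 i| ^+ 2 / 2) + a * rho ^- (i - j) * (`|w 0 j| ^+ 2 / 2)) <= _).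
  by apply: ler_sum => i _; apply: ler_sum.
under eq_bigr do rewrite big_split/=.
rewrite big_split/=.
have -> : sg / 4 * hform 1%:M w = \sum_i sg / 4 * (`|w 0 i| ^+ 2 / 2) +
    \sum_i sg / 4 * (`|w 0 i| ^+ 2 / 2).
  by rewrite -!mulr_sumr -!mulr_suml -hform1E; field.
apply: lerD.
  apply: ler_sum => i _; rewrite -mulr_suml ler_wpM2r ?divr_ge0 ?exprn_ge0//.
  rewrite -mulr_sumr.
  have -> : \sum_(j < n | (j < i)%N) rho ^- (i - j) = \sum_(j < i) rho ^- (i - j).
    by rewrite (big_ord_widen n (fun j => rho ^- (i - j)))// ltnW.
  apply: (sgsum _ i); first by rewrite sumr_ge0.
  exact: geometric_sum_left.
rewrite (exchange_big_dep xpredT)//=.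
apply: ler_sum => j _; rewrite -mulr_suml ler_wpM2r ?divr_ge0 ?exprn_ge0//.
rewrite -mulr_sumr; apply: (sgsum _ (n.-1 - j)%N); first by rewrite sumr_ge0.
exact: geometric_sum_right.
Qed.

Lemma trig_diag_eigenvalue n (A U : 'M[C]_n) : U \in unitmx ->
  is_trig_mx (U *m A *m invmx U) ->
  forall i, eigenvalue A ((U *m A *m invmx U) i i).
Proof.
move=> Uu Tt i; have : eigenvalue (U *m A *m invmx U) ((U *m A *m invmx U) i i).
  rewrite eigenvalue_root_char char_poly_trig// rootE horner_prod.
  by rewrite (bigD1 i)//= hornerXsubC subrr mul0r.
move=> /eigenvalueP[v vE v0]; apply/eigenvalueP; exists (v *m U).
  by rewrite scalemxAl -vE !mulmxA mulmxKV.
by apply: contra v0 => /eqP vU; rewrite -(mulmxK Uu v) vU mul0mx.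
Qed.

(* With [U A U^-1 = T] triangular and [S = diag (rho ^- (n-1-i))], the entries
   of [S^-1 T S] below the diagonal decay geometrically, so that the numerical
   range of [S^-1 (T - l) S] stays to the left of [- (sg + 2 l) / 2]. An
   eigenvector of [S U P U^-1 S] then has eigenvalue at most [1 / (sg + 2 l)]. *)
Lemma lyapunov_upper_bound n (A P : 'M[C]_n) (sg l a rho : C) : (0 < n)%N ->
  0 < sg -> 0 <= l -> 0 <= a -> rho = 1 + 4 * a / sg ->
  (forall z, eigenvalue A z -> 'Re z <= - sg) ->
  (forall x y : 'rV[C]_n, hform 1%:M x = 1 -> hform 1%:M y = 1 ->
    `|(x *m A *m y^t*) 0 0| <= a) ->
  P^t* = P -> (A - l%:M)^t* *m P + P *m (A - l%:M) = - 1%:M ->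
  forall y, hform P y <= rho ^+ n.-1 ^+ 2 / (sg + 2 * l) * hform 1%:M y.
Proof.
move=> n0 sg0 l0 a0 rhoE Asg Aa Ph lyap y.
have [U Uu] := Schur A n0.
have Ui := unitarymx_unit Uu.
rewrite /similar_to conjumx//; set T := U *m A *m invmx U => Tt.
have Td i : 'Re (T i i) <= - sg by apply/Asg/trig_diag_eigenvalue.
have Ta i j : `|T i j| <= a by rewrite /T invmx_unitary//; exact: unitary_coef_bound.
have sgl0 : 0 < sg + 2 * l by rewrite ltr_wpDr ?mulr_ge0.
have r1 : 1 <= rho by rewrite rhoE lerDl divr_ge0 ?mulr_ge0// ltW.
have r0 : 0 < rho by rewrite (lt_le_trans ltr01).
have rn0 : rho != 0 by rewrite gt_eqF.
have rR : rho \is Num.real by rewrite gtr0_real.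
pose sv := \row_(i < n) rho ^- (n.-1 - i); pose sv' := \row_(i < n) rho ^+ (n.-1 - i).
pose S := diag_mx sv; pose S' := diag_mx sv'.
have SS' : S *m S' = 1%:M.
  rewrite /S /S' mulmx_diag -diag_const_mx; congr diag_mx; apply/rowP => i.
  by rewrite !mxE mulVf// expf_neq0.
have S'S : S' *m S = 1%:M by exact: mulmx1C.
have St : S^t* = S.
  rewrite /S tr_diag_mx map_diag_mx; congr diag_mx; apply/rowP => i; rewrite !mxE.
  by apply/CrealP; rewrite rpredV rpredX.
pose M := S *m U *m P *m U^t* *m S.
have MP z : hform M z = hform P (z *m (S *m U)).
  by rewrite -hform_conj trmx_mul map_mxM St !mulmxA.
have Mh : M^t* = M.
  by rewrite /M !trmx_mul !map_mxM trmxCK St Ph !mulmxA.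
have SUnorm z : hform 1%:M (z *m (S *m U)) <= hform 1%:M z.
  rewrite mulmxA hform_unitary// !hform1E; apply: ler_sum => i _.
  rewrite mul_mx_diag !mxE normrM exprMn ler_piMr ?exprn_ge0//.
  have ri0 : 0 <= rho^-1 by rewrite invr_ge0 ltW.
  have ri1 : rho^-1 <= 1 by rewrite invf_le1.
  by rewrite -exprVn ger0_norm ?exprn_ge0// -exprM exprn_ile1.
have Mle : forall z, hform M z <= (sg + 2 * l)^-1 * hform 1%:M z.
  apply: rayleigh => // mu w w0 wM.
  pose x := w *m (S *m U).
  pose B := S' *m (T - l%:M) *m S.
  have w1 := hform1_gt0 w0.
  (* A real [mu] equals its conjugate, which lets [key] factor it out of a sum of two conjugate
     terms. *)
  have muR : mu \is Num.real.
    have : mu * hform 1%:M w = hform M w.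
      by rewrite /hform wM mulmx1 -scalemxAl [RHS]mxE.
    move=> /(canRL (mulfK (lt0r_neq0 w1)))->.
    apply: rpredM; last by rewrite rpredV gtr0_real.
    by apply/CrealP; rewrite -hform_adjoint Mh.
  (* Since [w] is an eigenvector of [M], [x P = mu w S' U]: the matrix [P] is traded for the scalar
     [mu], and [A] for its rescaled triangular form [B]. *)
  have xPE : hform (P *m (A - l%:M)) x = mu * hform B w.
    have xP : x *m P = mu *: (w *m S' *m U).
      have -> : x *m P = w *m M *m S' *m U.
        rewrite /x /M !mulmxA -(mulmxA _ S S') SS' mulmx1.
        by rewrite -(mulmxA _ (U^t*) U) -invmx_unitary// mulVmx// mulmx1.
      by rewrite wM -!scalemxAl.
    rewrite /hform mulmxA xP -!scalemxAl [LHS]mxE; congr (_ * _).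
    rewrite /x /B !trmx_mul !map_mxM St !mulmxA; congr ((_ *m _ *m _) _ _).
    rewrite -[in LHS](mulmxA _ _ (U^t*)) -!mulmxA; congr (_ *m (_ *m _)).
    rewrite !mulmxA -invmx_unitary// mulmxBr mulmxBl /T; congr (_ - _).
    by rewrite mul_mx_scalar -scalemxAl mulmxV// scalemx1.
  have key : mu * (hform B w + (hform B w)^*) = - hform 1%:M x.
    rewrite -hformN -lyap hformD mulrDr -xPE addrC; congr (_ + _).
    have -> : (A - l%:M)^t* *m P = (P *m (A - l%:M))^t*.
      by rewrite [in RHS]trmx_mul map_mxM Ph.
    by rewrite hform_adjoint xPE rmorphM/= (CrealP muR).
  have Bw : hform B w = \sum_i (T i i - l) * `|w 0 i| ^+ 2 +
     \sum_(i < n) \sum_(j < n | (j < i)%N) w 0 i * (T i j * rho ^- (i - j)) * (w 0 j)^*.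
    have -> : hform B w = \sum_i \sum_j w 0 i * B i j * (w 0 j)^*.
      rewrite /hform mxE exchange_big; apply: eq_bigr => j _ /=.
      by rewrite mxE mulr_suml; apply: eq_bigr => i _; rewrite !mxE.
    rewrite -big_split/=; apply: eq_bigr => i _.
    have BE j : B i j = rho ^+ (n.-1 - i) * (T i j - l *+ (i == j)) * rho ^- (n.-1 - j).
      by rewrite /B mul_mx_diag mul_diag_mx !mxE.
    rewrite (bigD1 i)//=; congr (_ + _).
      rewrite BE eqxx mulr1n normCK; field.
      by rewrite expf_neq0.
    rewrite big_mkcond [RHS]big_mkcond; apply: eq_bigr => j _.
    have jn : (j <= n.-1)%N by rewrite -ltnS prednK.
    have inn : (i <= n.-1)%N by rewrite -ltnS prednK.
    rewrite BE eq_sym -val_eqE/=; case: ltngtP => //= ij; last first.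
      by rewrite (is_trig_mxP Tt)// mulr0n subr0 !(mulr0,mul0r).
    rewrite mulr0n subr0; congr (_ * _ * _); rewrite mulrAC mulrC; congr (_ * _).
    have -> : (n.-1 - j = (n.-1 - i) + (i - j))%N by rewrite addnBA ?subnK// ltnW.
    by rewrite exprD invfM mulVKf// expf_neq0.
  have reB : hform B w + (hform B w)^* <= - (sg + 2 * l) * hform 1%:M w.
    have -> : hform B w + (hform B w)^* = 2 * 'Re (hform B w).
      by rewrite ReE mulrC divfK ?pnatr_eq0.
    rewrite Bw raddfD/=.
    (* The diagonal contributes at most [- (sg + l)] and the cross terms at most [sg / 4]; doubled,
       this beats [- (sg + 2 l)] by [sg / 2]. *)
    apply: le_trans (_ : 2 * (- (sg + l) * hform 1%:M w + sg / 4 * hform 1%:M w) <= _).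
      rewrite ler_pM2l ?ltr0n//; apply: lerD.
        rewrite raddf_sum hform1E mulr_sumr; apply: ler_sum => i _ /=.
        rewrite ReMr ?rpredX ?normr_real// ler_wpM2r ?exprn_ge0// raddfB/=.
        by rewrite (Creal_ReP _ (ger0_real l0)) opprD lerB.
      apply: le_trans (_ : `|\sum_(i < n) \sum_(j < n | (j < i)%N)
            w 0 i * (T i j * rho ^- (i - j)) * (w 0 j)^* | <= _).
        exact: (leif_Re_Creal _).1.
      apply: le_trans (ler_norm_sum _ _ _) _.
      apply: le_trans (ler_sum _ (fun i _ => ler_norm_sum _ _ _)) _.
      apply: weighted_cross_terms (Ta) => //; last exact: ltW.
      by rewrite rhoE; field; rewrite gt_eqF.
    rewrite -subr_ge0.
    have -> : - (sg + 2 * l) * hform 1%:M w -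
        2 * (- (sg + l) * hform 1%:M w + sg / 4 * hform 1%:M w)
      = sg / 2 * hform 1%:M w by field.
    by rewrite mulr_ge0 ?divr_ge0 ?ltW.
  (* By [key], this square is [mu] times a positive number, which settles the sign of [mu]. *)
  have : 0 <= hform 1%:M x by exact: hform1_ge0.
  rewrite -(opprK (hform 1%:M x)) -key -mulrN.
  have pos : 0 < - (hform B w + (hform B w)^*).
    by rewrite oppr_gt0 (le_lt_trans reB)// mulNr oppr_lt0 mulr_gt0.
  rewrite pmulr_lge0// => mu0.
  rewrite -[leRHS]mul1r ler_pdivlMr//.
  rewrite -(ler_pM2r w1) mul1r.
  apply: le_trans (SUnorm w); rewrite -/x -(opprK (hform 1%:M x)) -key -mulrN -mulrA.
  by rewrite ler_wpM2l// -[leLHS]opprK lerN2 -mulNr.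
(* Undoing the rescaling costs one factor [rho ^+ n.-1], the largest entry of [S'], in the norm,
   hence its square in the form. *)
have yE : y = y *m (U^t* *m S') *m (S *m U).
  rewrite -!mulmxA (mulmxA S') S'S mul1mx -invmx_unitary//.
  by rewrite mulVmx// mulmx1.
rewrite {1}yE -MP (le_trans (Mle _))// mulrC [in leRHS]mulrAC ler_wpM2r ?invr_ge0 ?(ltW sgl0)//.
rewrite -(hform_unitary y (_ : U^t* \is unitarymx)) ?trmxC_unitary// !hform1E mulmxA.
rewrite mulr_sumr; apply: ler_sum => i _.
rewrite mul_mx_diag [(\matrix_(_,_) _) _ _]mxE mxE normrM exprMn mulrC ler_wpM2r ?exprn_ge0//.
have r0' := ltW r0.
rewrite mxE normrX (gtr0_norm r0) lerXn2r ?nnegrE ?exprn_ge0//.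
by rewrite ler_weXn2l// leq_subr.
Qed.
End LyapunovUpperBound.

(** * Euclidean inner product, norm and operator norm *)

Section EuclideanNorm.
Variables (R : realType) (n : nat).
Implicit Types (u v w : 'cV[R]_n) (A : 'M[R]_n) (c : R).

Lemma dotE u v : dot u v = \sum_i u i 0 * v i 0.
Proof. by rewrite /dot mxE; apply: eq_bigr => i _; rewrite mxE. Qed.

Lemma dotC u v : dot u v = dot v u.
Proof. by rewrite !dotE; apply: eq_bigr => i _; rewrite mulrC. Qed.

Lemma dotDl u v w : dot (u + v) w = dot u w + dot v w.
Proof. by rewrite /dot linearD mulmxDl mxE. Qed.

Lemma dotZl c u v : dot (c *: u) v = c * dot u v.
Proof. by rewrite /dot linearZ -scalemxAl mxE. Qed.

Lemma dotNl u v : dot (- u) v = - dot u v.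
Proof. by rewrite -scaleN1r dotZl mulN1r. Qed.

Lemma dotBl u v w : dot (u - v) w = dot u w - dot v w.
Proof. by rewrite dotDl dotNl. Qed.

Lemma dotDr u v w : dot u (v + w) = dot u v + dot u w.
Proof. by rewrite dotC dotDl !(dotC u). Qed.

Lemma dotZr c u v : dot u (c *: v) = c * dot u v.
Proof. by rewrite dotC dotZl dotC. Qed.

Lemma dotNr u v : dot u (- v) = - dot u v.
Proof. by rewrite dotC dotNl dotC. Qed.

Lemma dotBr u v w : dot u (v - w) = dot u v - dot u w.
Proof. by rewrite dotDr dotNr. Qed.

Lemma dot_mull A u v : dot (A *m u) v = dot u (A^T *m v).
Proof. by rewrite /dot trmx_mul mulmxA. Qed.

Lemma qformE A u : qform A u = dot u (A *m u).
Proof. by rewrite /qform /dot mulmxA. Qed.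

Lemma dot_ge0 u : 0 <= dot u u.
Proof. by rewrite dotE sumr_ge0// => i _; rewrite -expr2 sqr_ge0. Qed.

Lemma enorm_ge0 u : 0 <= enorm u. Proof. exact: sqrtr_ge0. Qed.

Lemma enormE u : enorm u = Num.sqrt (dot u u).
Proof. by rewrite dotE. Qed.

Lemma enorm_sqr u : enorm u ^+ 2 = dot u u.
Proof. by rewrite enormE sqr_sqrtr ?dot_ge0. Qed.

Lemma enormZ c u : enorm (c *: u) = `|c| * enorm u.
Proof.
by rewrite !enormE dotZl dotZr mulrA -expr2 sqrtrM ?sqr_ge0// sqrtr_sqr.
Qed.

Lemma enorm0 : enorm (0 : 'cV[R]_n) = 0.
Proof. by rewrite -(scale0r 0) enormZ normr0 mul0r. Qed.

Lemma dot_eq0 u : dot u u = 0 -> u = 0.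
Proof.
rewrite dotE => /psumr_eq0P u0; apply/colP => i; rewrite mxE; apply/eqP.
by rewrite -sqrf_eq0 expr2 u0// => j _; rewrite -expr2 sqr_ge0.
Qed.

Lemma enorm_eq0 u : enorm u = 0 -> u = 0.
Proof. by move=> u0; apply: dot_eq0; rewrite -enorm_sqr u0 expr0n. Qed.

Lemma dot_gt0 u : u != 0 -> 0 < dot u u.
Proof. by rewrite lt_def dot_ge0 andbT; apply: contra => /eqP/dot_eq0 ->. Qed.

Lemma dot_CauchySchwarz u v : dot u v <= enorm u * enorm v.
Proof.
have [->|v0] := eqVneq v 0; first by rewrite dotC /dot linear0 mul0mx mxE mulr_ge0 ?enorm_ge0.
have vv := dot_gt0 v0.
(* This squared norm is [dot v v] times the defect in the Cauchy-Schwarz inequality. *)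
have := dot_ge0 (dot v v *: u - dot u v *: v).
rewrite !(dotBl, dotBr, dotZl, dotZr) (dotC v u).
have -> : dot v v * (dot v v * dot u u - dot u v * dot u v) -
  dot u v * (dot v v * dot u v - dot u v * dot v v) =
  dot v v * (dot u u * dot v v - dot u v ^+ 2) by ring.
rewrite pmulr_rge0// subr_ge0 -!enorm_sqr -exprMn => h.
apply: le_trans (ler_norm _) _.
by rewrite -ler_sqr ?nnegrE ?mulr_ge0 ?enorm_ge0// real_normK ?num_real.
Qed.

Lemma enormD u v : enorm (u + v) <= enorm u + enorm v.
Proof.
rewrite -ler_sqr ?nnegrE ?addr_ge0 ?enorm_ge0// sqrrD !enorm_sqr.
rewrite dotDl !dotDr (dotC v u) -!enorm_sqr.
by have := dot_CauchySchwarz u v; lra.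
Qed.

Lemma enormN u : enorm (- u) = enorm u.
Proof. by rewrite -scaleN1r enormZ normrN1 mul1r. Qed.

Lemma coord_le_enorm u i : `|u i 0| <= enorm u.
Proof.
rewrite -ler_sqr ?nnegrE ?enorm_ge0// enorm_sqr real_normK ?num_real// dotE.
by rewrite (bigD1 i)//= -expr2 lerDl sumr_ge0// => j _; rewrite -expr2 sqr_ge0.
Qed.

(** [opnorm] is a [sup], which bounds its set only if the set is known to be bounded. The sum of the
    column norms will do, as every coordinate of [v] has modulus at most [1]. *)
Lemma enorm_mulmx_bound A : exists B : R, forall v, enorm v <= 1 -> enorm (A *m v) <= B.
Proof.
exists (\sum_j enorm (col j A)) => v v1.
have -> : A *m v = \sum_j v j 0 *: col j A.
  apply/colP => i; rewrite mxE summxE; apply: eq_bigr => j _.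
  by rewrite !mxE mulrC.
elim/big_ind2 : _ => [||j _]; first by rewrite enorm0.
  by move=> x1 x2 y1 y2 h1 h2; rewrite (le_trans (enormD _ _))// lerD.
by rewrite enormZ ler_piMl ?enorm_ge0// (le_trans (coord_le_enorm _ _)).
Qed.

Lemma opnorm_ub A v : enorm v <= 1 -> enorm (A *m v) <= opnorm A.
Proof.
move=> v1; have [B AB] := enorm_mulmx_bound A.
apply: ub_le_sup; last by exists v.
by exists B => _ [w w1 <-]; exact: AB.
Qed.

Lemma opnorm_ge0 A : 0 <= opnorm A.
Proof. by apply: le_trans (@opnorm_ub A 0 _); rewrite ?enorm_ge0 ?enorm0. Qed.

Lemma enorm_mulmx A v : enorm (A *m v) <= opnorm A * enorm v.
Proof.
have [->|v0] := eqVneq v 0; first by rewrite mulmx0 enorm0 mulr0.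
have v1 : 0 < enorm v.
  by rewrite lt_def enorm_ge0 andbT; apply: contra v0 => /eqP/enorm_eq0 ->.
have := @opnorm_ub A ((enorm v)^-1 *: v).
rewrite -scalemxAr !enormZ gtr0_norm ?invr_gt0// mulVf ?gt_eqF// => /(_ (lexx _)).
by rewrite mulrC ler_pdivrMr.
Qed.
End EuclideanNorm.

(** * Real matrices seen as complex ones, and their spectra *)

Section RealToComplex.
Variables (R : realType) (n : nat).
Implicit Types (u v w : 'cV[R]_n) (A P S : 'M[R]_n) (y z : 'rV[R[i]]_n).
Local Open Scope sesquilinear_scope.
Local Notation "A ^cx" := (map_mx (real_complex R) A) (at level 1, format "A ^cx").

Lemma adjoint_real_complex m p (A : 'M[R]_(m, p)) : (A^cx)^t* = (A^T)^cx.
Proof.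
apply/matrixP => i j; rewrite !mxE; apply/CrealP.
by apply/complex_realP; exists (A j i).
Qed.

Lemma hform_real_complex A u : hform A^cx (u^T)^cx = (qform A u)%:C%C.
Proof. by rewrite /hform adjoint_real_complex trmxK -!map_mxM mxE. Qed.

Lemma hform1_real_complex u : hform 1%:M (u^T)^cx = (enorm u ^+ 2)%:C%C.
Proof.
rewrite -(map_mx1 (real_complex R)) hform_real_complex.
by rewrite qformE mul1mx enorm_sqr.
Qed.

Lemma hform1_Re_Im y :
  hform 1%:M y = (enorm (\col_i complex.Re (y 0 i)) ^+ 2 +
                  enorm (\col_i complex.Im (y 0 i)) ^+ 2)%:C%C.
Proof.
rewrite hform1E !enorm_sqr !dotE -big_split/= rmorph_sum/=.
by apply: eq_bigr => i _; rewrite !mxE -add_Re2_Im2 !expr2.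
Qed.

Lemma complex_CauchySchwarz (a : R) y z : 0 <= a ->
  hform 1%:M y <= 1 -> hform 1%:M z <= (a ^+ 2)%:C%C ->
  `|(y *m z^t*) 0 0| <= a%:C%C.
Proof.
move=> a0 y1 za.
pose ny := \col_i ComplexField.Normc.normc (y 0 i).
pose nz := \col_i ComplexField.Normc.normc (z 0 i).
have nE (x : 'rV[R[i]]_n) (x' := \col_i ComplexField.Normc.normc (x 0 i)) :
    hform 1%:M x = (enorm (x' : 'cV[R]_n) ^+ 2)%:C%C.
  rewrite hform1E enorm_sqr dotE rmorph_sum/=; apply: eq_bigr => i _.
  by rewrite !mxE -expr2 rmorphXn.
have yn : enorm ny <= 1.
  rewrite -(@ler_sqr R) ?nnegrE ?enorm_ge0// expr1n -lecR -nE.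
  by rewrite rmorph1.
have zn : enorm nz <= a.
  by rewrite -ler_sqr ?nnegrE ?enorm_ge0// -lecR -nE.
apply: (@le_trans _ _ (dot ny nz)%:C%C).
  rewrite mxE dotE rmorph_sum; apply: le_trans (ler_norm_sum _ _ _) _ => /=.
  apply: ler_sum => i _; rewrite !mxE normrM rmorphM/=.
  by rewrite -[leRHS]/(`|y 0 i| * `|z 0 i|) norm_conjC.
rewrite lecR (le_trans (dot_CauchySchwarz _ _))//.
by rewrite -[leRHS]mul1r ler_pM ?enorm_ge0.
Qed.

(** A real matrix acts separately on the real and imaginary parts of [z], whose squared norms add up
    to that of [z]. Hence the real operator norm also bounds the complex action. *)
Lemma complex_opnorm A y z : hform 1%:M y = 1 -> hform 1%:M z = 1 ->
  `|(y *m A^cx *m z^t*) 0 0| <= (opnorm A)%:C%C.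
Proof.
move=> y1 z1.
have -> : y *m A^cx *m z^t* = y *m (z *m (A^T)^cx)^t*.
  by rewrite trmx_mul map_mxM adjoint_real_complex trmxK mulmxA.
apply: complex_CauchySchwarz; rewrite ?opnorm_ge0 ?y1//.
move: z1; rewrite !hform1_Re_Im lecR.
set zr := \col_i complex.Re (z 0 i); set zi := \col_i complex.Im (z 0 i) => -[z1].
have -> : \col_i complex.Re ((z *m (A^T)^cx) 0 i) = A *m zr.
  apply/colP => i; rewrite !mxE raddf_sum; apply: eq_bigr => j _ /=.
  by rewrite !mxE; case: (z 0 j) => p q /=; rewrite mulr0 subr0 mulrC.
have -> : \col_i complex.Im ((z *m (A^T)^cx) 0 i) = A *m zi.
  apply/colP => i; rewrite !mxE raddf_sum; apply: eq_bigr => j _ /=.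
  by rewrite !mxE; case: (z 0 j) => p q /=; rewrite mulr0 add0r mulrC.
rewrite -[leRHS]mulr1 -z1 mulrDr -!exprMn.
by apply: lerD; rewrite ler_sqr ?nnegrE ?mulr_ge0 ?opnorm_ge0 ?enorm_ge0// enorm_mulmx.
Qed.

Lemma eigenvalue_real_complex A (x : R) : eigenvalue A^cx x%:C%C = eigenvalue A x.
Proof.
rewrite !eigenvalue_root_char -map_char_poly/=.
exact: (fmorph_root (real_complex R)).
Qed.

(** Apply [rayleigh] to the complexification of [- S]: its eigenvalues are real, so they are
    opposites of real eigenvalues of [S]. *)
Lemma real_rayleigh S (c : R) : S^T = S ->
  (forall x, eigenvalue S x -> c <= x) -> forall u, c * enorm u ^+ 2 <= qform S u.
Proof.
move=> Ssym Sc u.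
have := @rayleigh R[i] n (- S)^cx (- c)%:C%C.
rewrite adjoint_real_complex linearN/= Ssym => /(_ erefl) h.
have /h/(_ (u^T)^cx) : forall mu (w : 'rV_n), w != 0 -> w *m (- S)^cx = mu *: w -> mu <= (- c)%:C%C.
  move=> mu w w0 wS.
  have w1 := hform1_gt0 w0.
  have : mu * hform 1%:M w = hform (- S)^cx w.
    by rewrite /hform wS mulmx1 -scalemxAl [RHS]mxE.
  have hR : hform (- S)^cx w \is Num.real.
    by apply/CrealP; rewrite -hform_adjoint adjoint_real_complex linearN/= Ssym.
  move=> /(canRL (mulfK (lt0r_neq0 w1))) muE.
  have /complex_realP[k kE] : mu \is Num.real.
    by rewrite muE; apply: rpredM => //; rewrite rpredV gtr0_real.
  rewrite kE lecR lerNr; apply: Sc.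
  rewrite -eigenvalue_real_complex; apply/eigenvalueP; exists w => //.
  rewrite -[S]opprK map_mxN mulmxN wS kE -scaleNr; congr (_ *: _).
  by rewrite rmorphN.
by rewrite hform_real_complex hform1_real_complex -rmorphM/= lecR mulNr !qformE mulNmx dotNr lerN2.
Qed.

(** This makes the [inf] in [min_sym_eigenvalue] a genuine lower bound. *)
Lemma has_inf_sym_eigenvalue A :
  has_lbound [set z : R | eigenvalue (2^-1 *: (A + A^T)) z].
Proof.
set S := 2^-1 *: (A + A^T).
have Ssym : S^T = S by rewrite /S linearZ/= linearD/= trmxK addrC.
exists (- opnorm S) => z /eigenvalueP[w wS w0].
have w0' : w^T != 0 by apply: contra w0 => /eqP w0; rewrite -(trmxK w) w0 trmx0.
have Sw : S *m w^T = z *: w^T by rewrite -{1}Ssym -trmx_mul wS linearZ.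
have := enorm_mulmx S w^T; rewrite Sw enormZ ler_pM2r; last first.
  by rewrite enormE sqrtr_gt0 dot_gt0.
by rewrite ler_norml => /andP[].
Qed.

Lemma min_sym_eigenvalue_le A u : min_sym_eigenvalue A * enorm u ^+ 2 <= qform A u.
Proof.
have -> : qform A u = qform (2^-1 *: (A + A^T)) u.
  rewrite !qformE -scalemxAl dotZr mulmxDl dotDr -dot_mull (dotC (A *m u)).
  by field.
apply: real_rayleigh => [|x xA]; first by rewrite linearZ/= linearD/= trmxK addrC.
by apply: ge_inf => //; exact: has_inf_sym_eigenvalue.
Qed.

Lemma spectral_abscissa_ub A (z : R[i]) : hurwitz A -> ceigenvalue A z ->
  complex.Re z <= spectral_abscissa A.
Proof.
move=> Ah Az; apply: ub_le_sup; last by exists z.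
by exists 0 => _ [w wA <-]; exact/ltW/Ah.
Qed.

(** Strictness survives the [sup] because the spectrum is the finite set of roots of the
    characteristic polynomial, nonempty as [0 < n], so that the supremum is at most the real part of
    some eigenvalue. *)
Lemma spectral_abscissa_lt0 A : (0 < n)%N -> hurwitz A -> spectral_abscissa A < 0.
Proof.
move=> n0 Ah.
have [s sE] := closed_field_poly_normal (char_poly A^cx).
have As (z : R[i]) : ceigenvalue A z = (z \in s).
  rewrite /ceigenvalue eigenvalue_root_char sE (monicP (char_poly_monic _)) scale1r.
  exact: root_prod_XsubC.
have [z0 z0A] := eigenvalue_closed A^cx n0.
have s0 : (0 < size s)%N by have := As z0; rewrite /ceigenvalue z0A; case: (s).
pose f (i : 'I_(size s)) := complex.Re s`_i.
have [i0 _ fi0] := @arg_maxP _ R _ (Ordinal s0) xpredT f isT.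
apply: (@le_lt_trans _ _ (f i0)); last by apply: Ah; rewrite As mem_nth.
apply: ge_sup; first by exists (complex.Re z0), z0.
move=> _ [z /= + <-]; rewrite As => /(nthP 0)[i ilt <-].
exact: (fi0 (Ordinal ilt)).
Qed.
End RealToComplex.

(** * Two-sided bounds on a real solution of the Lyapunov equation *)

Section LyapunovEquation.
Variables (R : realType) (n : nat) (A P : 'M[R]_n) (l : R).
Hypothesis n_gt0 : (0 < n)%N.
Hypothesis Psym : P^T = P.
Hypothesis lyap : (A - l%:M)^T *m P + P *m (A - l%:M) = - 1%:M.
Local Notation toC := (real_complex R).
Implicit Type u : 'cV[R]_n.

Lemma lyapunov_dot u : 2 * dot (P *m u) ((A - l%:M) *m u) = - enorm u ^+ 2.
Proof.
have : qform ((A - l%:M)^T *m P + P *m (A - l%:M)) u = - enorm u ^+ 2.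
  by rewrite lyap qformE mulNmx mul1mx dotNr enorm_sqr.
rewrite qformE mulmxDl dotDr -!mulmxA -dot_mull -{2}Psym -dot_mull.
by move=> <-; rewrite (dotC ((A - l%:M) *m u)); ring.
Qed.

Lemma lyapunov_qform_ub u (sg := - spectral_abscissa A) : hurwitz A -> 0 <= l ->
  qform P u <= (1 + 4 * opnorm A / sg) ^+ n.-1 ^+ 2 / (sg + 2 * l) * enorm u ^+ 2.
Proof.
move=> Ah l0.
have sg0 : 0 < sg by rewrite oppr_gt0 spectral_abscissa_lt0.
have := @lyapunov_upper_bound R[i] n (map_mx toC A) (map_mx toC P) (toC sg) (toC l)
  (toC (opnorm A)) (toC (1 + 4 * opnorm A / sg)) n_gt0.
rewrite ltcR ler0c ler0c opnorm_ge0 sg0 l0.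
move=> /(_ isT isT isT) h.
have {}h := h _ _ (@complex_opnorm R n A) _ _ (map_mx toC u^T).
have : 1 + 4 * opnorm A / sg = 1 + 4 * opnorm A / sg by [].
have := h _ _ _ _.
rewrite hform_real_complex hform1_real_complex.
have -> : toC (1 + 4 * opnorm A / sg) ^+ n.-1 ^+ 2 / (toC sg + 2 * toC l) * toC (enorm u ^+ 2)
  = toC ((1 + 4 * opnorm A / sg) ^+ n.-1 ^+ 2 / (sg + 2 * l) * enorm u ^+ 2).
  move: (1 + _ / sg) => rho; rewrite [RHS]rmorphM; congr (_ * _).
  rewrite [RHS]fmorph_div; congr (_ / _); first by rewrite [RHS]rmorphXn [in RHS]rmorphXn.
  by rewrite [RHS]rmorphD [in RHS]rmorphM [in RHS]rmorph_nat.
move=> k _; rewrite -lecR; apply: k.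
- rewrite [LHS]rmorphD rmorph1; congr (_ + _).
  by rewrite [LHS]fmorph_div [in LHS]rmorphM [in LHS]rmorph_nat.
- move=> z Az; rewrite -complexRe -rmorphN lecR opprK.
  exact: spectral_abscissa_ub.
- by rewrite adjoint_real_complex Psym.
- rewrite -(map_scalar_mx toC) -map_mxB adjoint_real_complex -!map_mxM -map_mxD lyap.
  by rewrite map_mxN map_mx1.
Qed.

(** Paired with an eigenvector of [P], the Lyapunov equation involves [A] only through its quadratic
    form, which the least eigenvalue of the symmetric part bounds from below. *)
Lemma lyapunov_eigenvalue x : (forall u, u != 0 -> 0 < qform P u) ->
  eigenvalue P x -> 0 < x /\ 1 <= 2 * (- min_sym_eigenvalue A + l) * x.
Proof.
move=> Ppos /eigenvalueP[v vP v0].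
have u0 : v^T != 0 by apply: contra v0 => /eqP w0; rewrite -(trmxK v) w0 trmx0.
have Pu : P *m v^T = x *: v^T by rewrite -{1}Psym -trmx_mul vP linearZ.
have uu : 0 < enorm v^T ^+ 2 by rewrite enorm_sqr dot_gt0.
have x0 : 0 < x.
  have := Ppos _ u0; rewrite qformE Pu dotZr -enorm_sqr.
  by rewrite pmulr_lgt0.
split => //; have := lyapunov_dot v^T.
rewrite Pu dotZl mulmxBl dotBr -qformE mul_scalar_mx dotZr -enorm_sqr => h.
rewrite -(ler_pM2r uu) mul1r -[leLHS]opprK -h.
have := min_sym_eigenvalue_le A v^T; rewrite -(ler_pM2l x0); lra.
Qed.

Lemma lyapunov_qform_lb : (forall u, u != 0 -> 0 < qform P u) ->
  0 < - min_sym_eigenvalue A + l /\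
  forall u, enorm u ^+ 2 <= 2 * (- min_sym_eigenvalue A + l) * qform P u.
Proof.
move=> Ppos; set k := - min_sym_eigenvalue A + l.
have eigP x : eigenvalue P x -> 0 < x /\ 1 <= 2 * k * x.
  exact: lyapunov_eigenvalue.
have k0 : 0 < k.
  rewrite ltNge; apply/negP => k0.
  have noeig x : ~~ eigenvalue P x.
    apply/negP => /eigP[x0 /(lt_le_trans ltr01)].
    by rewrite pmulr_lgt0// pmulr_rgt0 ?ltr0n// ltNge k0.
  pose u : 'cV[R]_n := const_mx 1.
  have u0 : u != 0.
    apply/eqP => /colP/(_ (Ordinal n_gt0)); rewrite !mxE => /eqP.
    by rewrite oner_eq0.
  have uu : 0 < enorm u ^+ 2 by rewrite enorm_sqr dot_gt0.
  (* If [k <= 0], [P] has no real eigenvalue and the Rayleigh bound holds vacuously for every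
     constant; this one makes it read [qform P u + 1 <= qform P u]. *)
  have := @real_rayleigh R n P ((qform P u + 1) / enorm u ^+ 2) Psym _ u.
  rewrite divfK ?gt_eqF// => /(_ _)/= h.
  suff : qform P u + 1 <= qform P u by lra.
  by apply: h => x xP; have := noeig x; rewrite xP.
split => // u.
have k20 : 0 < 2 * k by rewrite mulr_gt0.
have := @real_rayleigh R n P (2 * k)^-1 Psym _ u.
rewrite ler_pdivrMl//; apply => x /eigP[_].
by rewrite -[X in _ -> X <= _]mulr1 ler_pdivrMl.
Qed.
End LyapunovEquation.

(** * Absolute continuity and derivatives known almost everywhere *)

Section AbsoluteContinuity.
Variable R : realType.
Implicit Types (g : R -> R) (a b c e t : R).

Lemma is_derive1P g t d : is_derive t 1 g d <->
  forall e, 0 < e -> exists2 rho, 0 < rho &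
    forall s, `|s - t| < rho -> `|g s - g t - d * (s - t)| <= e * `|s - t|.
Proof.
split=> [[gt gd] e e0|H].
  have : h^-1 *: (g (h *: 1 + t) - g t) @[h --> 0^'] --> d by rewrite -gd; exact: gt.
  move=> /cvgrPdist_le/(_ e e0)[rho /= rho0 H]; exists rho => // s st.
  have [->|sNt] := eqVneq s t; first by rewrite !subrr mulr0 subr0 normr0 mulr0.
  have s0 : s - t != 0 by rewrite subr_eq0.
  have := H (s - t); rewrite /ball_/= sub0r normrN => /(_ st s0).
  rewrite -[(s - t) *: 1]/((s - t) * 1) mulr1 subrK => h.
  have -> : g s - g t - d * (s - t) = - (d - (s - t)^-1 * (g s - g t)) * (s - t) by field.
  by rewrite normrM normrN ler_wpM2r.
suff gd : h^-1 *: (g (h *: 1 + t) - g t) @[h --> 0^'] --> d.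
  by split; [apply/cvg_ex; exists d|exact/cvg_lim].
apply/cvgrPdist_le => e e0; have [rho rho0 {}H] := H e e0.
exists rho => //= h; rewrite /ball_/= sub0r normrN => hrho h0.
have := H (h + t); rewrite addrK => /(_ hrho).
rewrite -[h *: 1]/(h * 1) mulr1 => {}H.
rewrite -(ler_pM2r (x := `|h|)) ?normr_gt0// distrC -normrM.
by rewrite mulrBl -[_ *: _]/(_ * _) mulrAC mulVf// mul1r.
Qed.

(* Absolute continuity with the intervals listed from left to right. *)
Definition incr_abs_continuous a b g := forall e, 0 < e ->
  exists2 delta, 0 < delta & forall (k : nat) (u v : nat -> R),
    (forall i, (i < k)%N -> a <= u i <= v i /\ v i <= b) ->
    (forall i j, (i < j < k)%N -> v i <= u j) ->
    \sum_(i < k) (v i - u i) < delta -> \sum_(i < k) `|g (v i) - g (u i)| < e.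

Lemma abs_continuous_coord n a b (z : R -> 'cV[R]_n) i :
  abs_continuous_on a b z -> incr_abs_continuous a b (fun t => z t i 0).
Proof.
move=> zac e e0; have [delta delta0 H] := zac e e0; exists delta => // k u v uv vu uvd.
apply: le_lt_trans (H k (fun j => u j) (fun j => v j) _ _ uvd).
- apply: ler_sum => j _; have := coord_le_enorm (z (v j) - z (u j)) i.
  by rewrite !mxE.
- by move=> j; have [/andP[]] := uv j (ltn_ord j).
- have disj (p q : 'I_k) : (p < q)%N -> ~ (`]u p, v p[ `&` `]u q, v q[%classic !=set0).
    move=> pq [x []]; rewrite /= !in_itv/= => /andP[_ xp] /andP[qx _].
    have := vu p q; rewrite pq ltn_ord => /(_ isT) h.
    by have := lt_trans xp (le_lt_trans h qx); rewrite ltxx.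
  move=> p q _ _ pq; apply/val_inj; case: (ltngtP p q) => // /disj; last by rewrite setIC.
  by [].
Qed.

Local Notation mu := (@lebesgue_measure R).

Lemma negligible_open_cover (N : set R) e : mu.-negligible N -> 0 < e ->
  exists U : set R, [/\ open U, N `<=` U & (mu U < e%:E)%E].
Proof.
move=> [A [mA A0 NA]] e0.
have Afin : (mu A < +oo)%E by rewrite A0.
have [U [oU AU Ue]] := lebesgue_regularity_outer mA Afin e0.
exists U; split => //; first exact: subset_trans AU.
have mU : measurable U by exact: open_measurable.
have -> : U = (U `\` A) `|` A by rewrite setUC setDUK.
by rewrite measureU0//; exact: measurableD.
Qed.

Section SupArgument.
Variables (g : R -> R) (a b c e : R) (U : set R).
Hypothesis ab : a <= b.
Hypothesis e_ge0 : 0 <= e.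
Hypothesis oU : open U.
Hypothesis good : forall t, a <= t <= b -> ~ U t -> exists2 rho, 0 < rho &
  forall s, `|s - t| < rho -> `|g s - g t - c * (s - t)| <= e * `|s - t|.

(* The intervals carry the part of the increment accumulated near the bad
   points, all of which lie in [U]. *)
Let Q t := exists (k : nat) (u v : nat -> R),
  [/\ forall i, (i < k)%N -> a <= u i <= v i /\ v i <= t,
      forall i j, (i < j < k)%N -> v i <= u j,
      ((\sum_(i < k) (v i - u i))%:E <= mu (U `&` [set x | (x < t)%R]))%E &
      `|g t - g a - c * (t - a)| <= e * (t - a) +
        \sum_(i < k) (`|g (v i) - g (u i)| + `|c| * (v i - u i))].

Let measurable_below t : measurable (U `&` [set x | (x < t)%R] : set R).
Proof.
apply: measurableI; first exact: open_measurable.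
rewrite (_ : [set x | x < t] = `]-oo, t[%classic); first exact: measurable_itv.
by apply/seteqP; split => x /=; rewrite in_itv.
Qed.

Let Q_good s t : s <= t -> `|g t - g s - c * (t - s)| <= e * (t - s) -> Q s -> Q t.
Proof.
move=> st gst [k [u [v [uv vu mk gk]]]]; exists k, u, v; split => //.
- by move=> i ik; have [-> h] := uv i ik; rewrite (le_trans h).
- apply: le_trans mk _; apply: le_measure; rewrite ?inE; [exact: measurable_below..|].
  by move=> x /= [Ux xs]; split => //=; exact: lt_le_trans st.
- have -> : g t - g a - c * (t - a) =
    (g t - g s - c * (t - s)) + (g s - g a - c * (s - a)) by ring.
  by apply: le_trans (ler_normD _ _) _; lra.
Qed.

(** The length of the appended interval is paid for by a part of [U] disjoint from the part below
    [s], so the total length stays within the measure of [U]. *)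
Let Q_bad s t : a <= s -> s <= t -> `]s, t[ `<=` U -> Q s -> Q t.
Proof.
move=> as_ st stU [k [u [v [uv vu mk gk]]]].
pose u' i := if i == k then s else u i; pose v' i := if i == k then t else v i.
have sumE (F : R -> R -> R) : \sum_(i < k.+1) F (v' i) (u' i) =
    \sum_(i < k) F (v i) (u i) + F t s.
  rewrite big_ord_recr/= /u' /v' eqxx; congr (_ + _).
  by apply: eq_bigr => i _; rewrite ltn_eqF.
exists k.+1, u', v'; split.
- move=> i; rewrite ltnS leq_eqVlt /u' /v'; case: eqVneq => /= [_ _|_ ik].
    by rewrite as_ st.
  by have [-> h] := uv _ ik; rewrite (le_trans h).
- move=> i j /andP[ij]; rewrite ltnS leq_eqVlt /u' /v'; case: (eqVneq j k) => /= [jk _|_ jk].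
    have ik : (i < k)%N by rewrite -jk.
    by rewrite ltn_eqF//; have [] := uv i ik.
  have ik : (i < k)%N := ltn_trans ij jk.
  by rewrite ltn_eqF//; apply: vu; rewrite ij.
- rewrite (sumE (fun x y => x - y)) EFinD.
  have stE : ((t - s)%:E <= mu `]s, t[%classic)%E.
    rewrite lebesgue_measure_itv/= lte_fin.
    by case: ltP => // ts; rewrite lee_fin subr_le0.
  apply: (@le_trans _ _ (mu ((U `&` [set x | (x < s)%R]) `|` `]s, t[%classic))).
    rewrite measureU; [|exact: measurable_below|exact: measurable_itv|]; last first.
      rewrite -subset0 => x [[_ /= xs]]; rewrite in_itv/= => /andP[sx _].
      by have := lt_trans xs sx; rewrite ltxx.
    exact: leeD.
  apply: le_measure; rewrite ?inE; [|exact: measurable_below|].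
    by apply: measurableU; [exact: measurable_below|exact: measurable_itv].
  move=> x /= [[Ux xs]|xst]; first by split => //=; exact: lt_le_trans st.
  split; first exact: stU.
  by move: xst; rewrite /= in_itv => /andP[].
- rewrite (sumE (fun x y => `|g x - g y| + `|c| * (x - y))).
  have -> : g t - g a - c * (t - a) =
    (g s - g a - c * (s - a)) + (g t - g s - c * (t - s)) by ring.
  apply: le_trans (ler_normD _ _) _.
  have := ler_normB (g t - g s) (c * (t - s)).
  rewrite normrM (ger0_norm (_ : 0 <= t - s)) ?subr_ge0// => h.
  have : e * (s - a) <= e * (t - a) by rewrite ler_wpM2l ?lerB.
  lra.
Qed.

(** At a good [x], the estimates for [s <= x] and [x <= t] add up without loss because
    [(x - s) + (t - x) = t - s]. At [x] in [U], a whole neighbourhood lies in [U] and one more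
    interval is appended. *)
Let Q_step x : a <= x <= b -> exists2 rho, 0 < rho & forall s t,
  x - rho < s -> s <= x -> x <= t -> t < x + rho -> a <= s -> Q s -> Q t.
Proof.
move=> xab; have [Ux|/good] := pselect (U x); last first.
  move=> /(_ xab)[rho rho0 H]; exists rho => // s t xs sx xt tx as_.
  apply: Q_good; first exact: le_trans xt.
  have -> : g t - g s - c * (t - s) =
    (g t - g x - c * (t - x)) - (g s - g x - c * (s - x)) by ring.
  apply: le_trans (ler_normB _ _) _.
  have := H t; rewrite ger0_norm ?subr_ge0// => /(_ _) h1.
  have := H s; rewrite ler0_norm ?subr_le0// => /(_ _) h2.
  have : t - x < rho by lra.
  have : - (s - x) < rho by lra.
  by move=> /h2 + /h1; lra.
have [rho /= rho0 H] := (nbhs_ballP x U).1 (open_nbhs_nbhs (conj oU Ux)).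
exists rho => // s t xs sx xt tx as_; apply: Q_bad => //; first exact: le_trans xt.
move=> y; rewrite /= in_itv/= => /andP[sy yt]; apply: H.
by rewrite /ball/= ltr_distlC; apply/andP; split; lra.
Qed.

(** Continuous induction: [Q] holds at points arbitrarily close to the left of the supremum of the
    points reached, or at it, and [Q_step] carries it across. The supremum would be exceeded unless
    [b] is reached. *)
Lemma increment_open_cover : exists (k : nat) (u v : nat -> R),
  [/\ forall i, (i < k)%N -> a <= u i <= v i /\ v i <= b,
      forall i j, (i < j < k)%N -> v i <= u j,
      ((\sum_(i < k) (v i - u i))%:E <= mu U)%E &
      `|g b - g a - c * (b - a)| <= e * (b - a) +
        \sum_(i < k) (`|g (v i) - g (u i)| + `|c| * (v i - u i))].
Proof.
suff : Q b.
  move=> [k [u [v [uv vu mk gk]]]]; exists k, u, v; split => //.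
  apply: le_trans mk _; apply: le_measure; rewrite ?inE.
  - exact: measurable_below.
  - exact: open_measurable.
  - by move=> x [].
pose S := [set t | a <= t <= b /\ Q t].
have Sa : S a.
  split; first by rewrite lexx.
  exists 0%N, (fun=> 0), (fun=> 0); split => //; first by rewrite big_ord0.
  by rewrite !subrr mulr0 subr0 normr0 mulr0 big_ord0 addr0.
have Sub : has_ubound S by exists b => t [/andP[]].
have Ssup : has_sup S by split => //; exists a.
set x := sup S.
have ax : a <= x by exact: ub_le_sup.
have xb : x <= b by apply: ge_sup; [exists a|move=> t [/andP[]]].
have xab : a <= x <= b by rewrite ax.
have [rho rho0 H] := Q_step xab.
have [s [/andP[as_ sb] Qs] xs] := sup_adherent rho0 Ssup.
have sx : s <= x by apply: ub_le_sup => //; split => //; rewrite as_.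
have [bx|bx] := ltP b (x + rho); first exact: (H s b).
have : S (x + rho / 2).
  split; first by apply/andP; split; lra.
  by apply: (H s) => //; lra.
by move=> /(ub_le_sup Sub); rewrite -/x; lra.
Qed.
End SupArgument.

(** A mean value inequality: the exceptional set is enclosed in an open set of tiny measure, on
    which absolute continuity makes the increments negligible. *)
Lemma abs_continuous_increment g (G : R -> R) a b c e : a <= b -> 0 <= e ->
  incr_abs_continuous a b g ->
  {ae mu, forall t, a < t < b -> is_derive t (1 : R) g (G t)} ->
  (forall t, a < t < b -> `|G t - c| <= e) ->
  `|g b - g a - c * (b - a)| <= e * (b - a).
Proof.
move=> ab e0 gac gG Gc; apply/ler_addgt0Pr => eta eta0.
(* The budget: [eta' * (b - a)] for linearization at the good points, [eta'] for the increments of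
   [g] over the bad intervals, and [eta'] for [c] times their lengths. *)
pose eta' := eta / (b - a + 2).
have ba0 : 0 < b - a + 2 by lra.
have eta'0 : 0 < eta' by rewrite divr_gt0.
have [delta delta0 H] := gac eta' eta'0.
pose d := Num.min delta (eta' / (`|c| + 1)).
have c1 : 0 < `|c| + 1 by rewrite ltr_wpDl.
have d0 : 0 < d by rewrite lt_min delta0 divr_gt0.
have [A [mA A0 NA]] := gG.
(* The endpoints join the exceptional set because the derivative is only known strictly between
   them. *)
have [|U [oU NU Ud]] := @negligible_open_cover (A `|` [set a; b]) d _ d0.
  have m1 (x : R) : measurable ([set x] : set R) by exact: measurable_set1.
  have m2 : measurable ([set a; b] : set R) by exact: measurableU.
  have m0 : mu [set a; b] = 0%E.
    rewrite measureU0; [exact: lebesgue_measure_set1|exact: m1|exact: m1|].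
    exact: lebesgue_measure_set1.
  exists (A `|` [set a; b]); split => //; first exact: measurableU.
  by rewrite measureU0.
have good t : a <= t <= b -> ~ U t -> exists2 rho, 0 < rho &
    forall s, `|s - t| < rho -> `|g s - g t - c * (s - t)| <= (e + eta') * `|s - t|.
  move=> /andP[at_ tb] Ut.
  have tab : a < t < b.
    rewrite !lt_neqAle at_ tb !andbT; apply/andP; split; apply/eqP => E.
      by apply: Ut; apply: NU; right; left.
    by apply: Ut; apply: NU; right; right.
  have /is_derive1P/(_ _ eta'0)[rho rho0 gt] : is_derive t (1 : R) g (G t).
    apply: contrapT => gt; apply: Ut; apply: NU; left; apply: NA => /= /(_ tab).
    by [].
  exists rho => // s /gt h.
  have -> : g s - g t - c * (s - t) =
    (g s - g t - G t * (s - t)) + (G t - c) * (s - t) by ring.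
  apply: le_trans (ler_normD _ _) _; rewrite normrM mulrDl addrC lerD//.
  by rewrite ler_wpM2r// Gc.
have [k [u [v [uv vu mk gk]]]] :=
  @increment_open_cover g a b c (e + eta') U ab (addr_ge0 e0 (ltW eta'0)) oU good.
have sd : \sum_(i < k) (v i - u i) < d by rewrite -lte_fin (le_lt_trans mk).
have {}H := H k u v uv vu (lt_le_trans sd _).
rewrite (le_trans gk)// big_split/= -mulr_sumr.
have h1 : \sum_(i < k) `|g (v i) - g (u i)| < eta' by apply: H; rewrite ge_min lexx.
have h2 : `|c| * \sum_(i < k) (v i - u i) <= eta'.
  apply: (@le_trans _ _ (`|c| * (eta' / (`|c| + 1)))).
    by rewrite ler_wpM2l// (le_trans (ltW sd))// ge_min lexx orbT.
  by rewrite mulrCA ler_piMr ?(ltW eta'0)// ler_pdivrMr// mul1r lerDl.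
have h3 : eta' * (b - a + 2) = eta by rewrite divfK// gt_eqF.
by rewrite mulrDl; lra.
Qed.

(** Near [t] the values of [G] are within [e] of [G t], so the mean value inequality between [t] and
    [s] is the definition of the derivative. *)
Lemma abs_continuous_is_derive g (G : R -> R) a b t : a < t < b ->
  incr_abs_continuous a b g ->
  {ae mu, forall t, a < t < b -> is_derive t (1 : R) g (G t)} ->
  {for t, continuous G} -> is_derive t (1 : R) g (G t).
Proof.
move=> /andP[at_ tb] gac gG Gt; apply/is_derive1P => e e0.
move: Gt => /cvgrPdist_le/(_ e e0)[rho0 /= rho00 Grho].
pose rho := Num.min rho0 (Num.min (t - a) (b - t)).
have rho_gt0 : 0 < rho by rewrite !lt_min rho00 !subr_gt0 at_ tb.
have sub p q : t - rho <= p -> p <= q -> q <= t + rho -> t - rho < q -> p < t + rho ->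
    `|g q - g p - G t * (q - p)| <= e * (q - p).
  have [r1 r2 r3] : [/\ rho <= rho0, rho <= t - a & rho <= b - t].
    by rewrite /rho !ge_min !lexx !orbT.
  move=> p1 pq q1 _ _; apply: (@abs_continuous_increment g G) => //; first exact: ltW.
  - move=> eta eta0; have [delta delta0 H] := gac eta eta0; exists delta => //.
    move=> k u v uv; apply: H => i /uv[/andP[h1 h2] h3]; rewrite h2.
    by split; lra.
  - have [N [mN N0 NG]] := gG; exists N; split => // s /= gs; apply: NG => /= h.
    by apply: gs => /andP[ps sq]; apply: h; apply/andP; split; lra.
  - move=> s /andP[ps sq]; rewrite distrC; apply: Grho => /=.
    by rewrite ltr_distlC; apply/andP; split; lra.
exists rho => // s; rewrite ltr_distl => /andP[ts st].
have [les|les] := leP t s.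
  by rewrite (ger0_norm (_ : 0 <= s - t)) ?subr_ge0//; apply: sub; lra.
rewrite (ltr0_norm (_ : s - t < 0)) ?subr_lt0// opprB.
have -> : g s - g t - G t * (s - t) = - (g t - g s - G t * (t - s)) by ring.
by rewrite normrN; apply: sub; lra.
Qed.

Lemma abs_continuous_dist g a b : incr_abs_continuous a b g ->
  forall e, 0 < e -> exists2 delta, 0 < delta &
    forall s t, a <= s -> s <= t -> t <= b -> t - s < delta -> `|g t - g s| < e.
Proof.
move=> gac e e0; have [delta delta0 H] := gac e e0; exists delta => // s t as_ st tb d.
have := H 1%N (fun=> s) (fun=> t); rewrite !big_ord1; apply => //.
  by move=> i _; rewrite as_ st.
by move=> i [|j] /andP[].
Qed.
End AbsoluteContinuity.

(** * Limits and derivatives of vector functions *)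

Section Coordinatewise.
Variables (R : realType) (n : nat).
Implicit Types (z w : R -> 'cV[R]_n) (p q : 'cV[R]_n) (f g : R -> R).

(* Convergence and differentiation are handled coordinatewise, since the
   topology of ['cV_n] comes from the max norm. *)
Definition coord_cvg (F : set_system R) z p :=
  forall i, z s i 0 @[s --> F] --> p i 0.

Definition coord_derive t z p := forall i, is_derive t (1 : R) (fun s => z s i 0) (p i 0).

Lemma cvg_maxr (F : set_system R) {FF : Filter F} f g (a b : R) :
  f s @[s --> F] --> a -> g s @[s --> F] --> b ->
  Num.max (f s) (g s) @[s --> F] --> Num.max a b.
Proof.
move=> fa gb; rewrite maxr_absE.
under eq_fun do rewrite maxr_absE.
apply: cvgM; last exact: cvg_cst.
by apply: cvgD; [exact: cvgD|apply: cvg_norm; exact: cvgB].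
Qed.

Section Limits.
Context (F : set_system R) {FF : Filter F}.

Lemma cvg_sumr k (h : 'I_k -> R -> R) (l : 'I_k -> R) :
  (forall i, h i s @[s --> F] --> l i) ->
  \sum_i h i s @[s --> F] --> \sum_i l i.
Proof.
move=> hl; elim: k h l hl => [|k IH] h l hl.
  under eq_fun do rewrite big_ord0.
  by rewrite big_ord0; exact: cvg_cst.
under eq_fun do rewrite big_ord_recr.
by rewrite big_ord_recr; apply: cvgD; [exact: IH|exact: hl].
Qed.

Lemma coord_cvg_cst p : coord_cvg F (fun=> p) p.
Proof. by move=> i; exact: cvg_cst. Qed.

Lemma coord_cvgD z w p q : coord_cvg F z p -> coord_cvg F w q ->
  coord_cvg F (fun s => z s + w s) (p + q).
Proof.
move=> zp wq i; rewrite mxE; under eq_fun do rewrite mxE.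
exact: cvgD.
Qed.

Lemma coord_cvgN z p : coord_cvg F z p -> coord_cvg F (fun s => - z s) (- p).
Proof.
move=> zp i; rewrite mxE; under eq_fun do rewrite mxE.
exact: cvgN.
Qed.

Lemma coord_cvgB z w p q : coord_cvg F z p -> coord_cvg F w q ->
  coord_cvg F (fun s => z s - w s) (p - q).
Proof. by move=> zp wq; apply: coord_cvgD => //; exact: coord_cvgN. Qed.

Lemma coord_cvgZ f z (a : R) p : f s @[s --> F] --> a -> coord_cvg F z p ->
  coord_cvg F (fun s => f s *: z s) (a *: p).
Proof.
move=> fa zp i; rewrite mxE; under eq_fun do rewrite mxE.
exact: cvgM.
Qed.

Lemma coord_cvg_mulmx (A : 'M[R]_n) z p : coord_cvg F z p ->
  coord_cvg F (fun s => A *m z s) (A *m p).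
Proof.
move=> zp i; rewrite mxE; under eq_fun do rewrite mxE.
apply: cvg_sumr => j; apply: cvgM => //; exact: cvg_cst.
Qed.

Lemma cvg_dot z w p q : coord_cvg F z p -> coord_cvg F w q ->
  dot (z s) (w s) @[s --> F] --> dot p q.
Proof.
move=> zp wq; rewrite dotE; under eq_fun do rewrite dotE.
by apply: cvg_sumr => j; exact: cvgM.
Qed.
End Limits.

Lemma coord_deriveB t z w p q : coord_derive t z p -> coord_derive t w q ->
  coord_derive t (fun s => z s - w s) (p - q).
Proof.
move=> zp wq i; rewrite !mxE.
rewrite (_ : (fun s => _) = (fun s => z s i 0) - (fun s => w s i 0)).
  exact: is_deriveB.
by apply/funext => s; rewrite !mxE.
Qed.

Lemma coord_derive_cst t p : coord_derive t (fun=> p) 0.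
Proof. by move=> i; rewrite mxE; exact: is_derive_cst. Qed.

Lemma coord_derive_mulmx (A : 'M[R]_n) t z p : coord_derive t z p ->
  coord_derive t (fun s => A *m z s) (A *m p).
Proof.
move=> zp i; rewrite mxE.
rewrite (_ : (fun s => _) = \sum_j (A i j \*: (fun s => z s j 0))).
  by apply: is_derive_sum => j; exact: is_deriveZ.
by apply/funext => s; rewrite mxE fct_sumE.
Qed.

Lemma is_derive_dot t z w p q : coord_derive t z p -> coord_derive t w q ->
  is_derive t (1 : R) (fun s => dot (z s) (w s)) (dot p (w t) + dot (z t) q).
Proof.
move=> zp wq.
rewrite (_ : (fun s => _) = \sum_j ((fun s => z s j 0) * (fun s => w s j 0))).
  rewrite !dotE -big_split/=.
  rewrite (_ : \sum_i _ = \sum_i (z t i 0 *: q i 0 + w t i 0 *: p i 0)).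
    by apply: is_derive_sum => j; exact: is_deriveM.
  by apply: eq_bigr => j _; rewrite addrC [p _ _ * _]mulrC.
by apply/funext => s; rewrite dotE fct_sumE.
Qed.

Lemma is_derive_qform (A : 'M[R]_n) t z p : A^T = A -> coord_derive t z p ->
  is_derive t (1 : R) (fun s => qform A (z s)) (2 * dot (A *m z t) p).
Proof.
move=> AT zp; under eq_fun do rewrite qformE.
have := is_derive_dot zp (coord_derive_mulmx A zp).
by rewrite -{3}AT -dot_mull (dotC p) -mulr2n mulr_natl.
Qed.

Lemma is_derive_coord t z p : is_derive t (1 : R) z p -> coord_derive t z p.
Proof.
move=> [zt zp] i; have /derivable_mxP zt' := zt.
split; first exact: zt'.
by rewrite -zp derive_mx// mxE.
Qed.
End Coordinatewise.

(** * The projection operator as a continuous map *)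

Section ProjectionOperator.
Variables (R : realType) (n : nat) (gam vth eps : R).
Hypotheses (gam_gt0 : 0 < gam) (vth_gt0 : 0 < vth) (eps_gt0 : 0 < eps).
Implicit Types (p y : 'cV[R]_n).

Let D : R := 2 * eps * vth + eps ^+ 2.

Let D_gt0 : 0 < D. Proof. by rewrite addr_gt0 ?exprn_gt0// !mulr_gt0. Qed.

Lemma gradient_proj_fun p : gradient (proj_fun vth eps) p = (2 / D) *: p.
Proof.
apply/colP => i; rewrite !mxE; apply/cvg_lim => //.
(* The difference quotient of this quadratic function is off by exactly [h / D]. *)
apply/cvgrPdist_le => e e0; exists (e * D) => /=; first by rewrite mulr_gt0.
move=> h; rewrite /ball_/= sub0r normrN => hD h0.
rewrite /proj_fun -/D !enorm_sqr dotDl !dotDr !(dotZl, dotZr) (dotC p).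
have -> : dot (delta_mx i 0) p = p i 0.
  rewrite dotE (bigD1 i)//= mxE !eqxx mul1r big1 ?addr0// => j ji.
  by rewrite mxE (negbTE ji) mul0r.
have -> : dot (delta_mx i 0) (delta_mx i 0 : 'cV[R]_n) = 1.
  rewrite dotE (bigD1 i)//= !mxE !eqxx mul1r big1 ?addr0// => j ji.
  by rewrite !mxE (negbTE ji) mul0r.
rewrite -[_ *: (_ - _)]/(_ * _).
have -> : 2 / D * p i 0 - h^-1 * ((h * (h * 1) + h * p i 0 + (h * p i 0 + dot p p) -
    vth ^+ 2) / D - (dot p p - vth ^+ 2) / D) = - h / D.
  by field; rewrite h0 gt_eqF.
by rewrite normrM normrN normfV (gtr0_norm D_gt0) ler_pdivrMr// ltW.
Qed.

(** For [q] the squared norm of [p], this is the positive part of [f p] divided by [q]. The maximum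
    in the denominator equals [q] wherever the numerator is nonzero and stays away from [0], so the
    case distinction in [Proj] becomes a visibly continuous formula. *)
Definition proj_gain (q : R) : R := Num.max 0 (q - vth ^+ 2) / (D * Num.max q (vth ^+ 2)).

Definition proj_ext p y : 'cV[R]_n :=
  gam *: (y - (proj_gain (dot p p) * Num.max 0 (dot p y)) *: p).

Lemma ProjE p y : Proj gam%:M p y (proj_fun vth eps) = proj_ext p y.
Proof.
have c0 : 0 < 2 / D by rewrite divr_gt0.
rewrite /Proj gradient_proj_fun !mul_scalar_mx !dotZr dotZl (dotC y).
rewrite /proj_fun -/D enorm_sqr pmulr_lgt0 ?invr_gt0// subr_gt0.
rewrite pmulr_rgt0// pmulr_rgt0// /proj_ext /proj_gain.
case: (ltP (vth ^+ 2) (dot p p)) => [qv|qv] /=; last first.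
  by rewrite max_l ?subr_le0// !mul0r scale0r subr0.
case: (ltP 0 (dot p y)) => [py|py]; last by rewrite mulr0 scale0r subr0.
have q0 : 0 < dot p p by rewrite (lt_trans _ qv)// exprn_gt0.
rewrite max_r ?subr_ge0 ?(ltW qv)// scalerBr; congr (_ - _).
have ppy : p *m p^T *m y = dot p y *: p.
  rewrite -mulmxA (_ : p^T *m y = (dot p y)%:M) ?mul_mx_scalar//.
  by apply/matrixP => i j; rewrite !ord1 [RHS]mxE eqxx mulr1n.
have gg (c : R) : (c *: p) *m (c *: p)^T = c ^+ 2 *: (p *m p^T).
  by rewrite [(c *: p)^T]linearZ/= -scalemxAl -scalemxAr scalerA.
rewrite gg mul_mx_scalar -!scalemxAl ppy !scalerA; congr (_ *: _); field.
by rewrite !gt_eqF.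
Qed.

Lemma proj_gain_ge0 q : 0 <= proj_gain q.
Proof.
rewrite divr_ge0 ?le_max ?lexx// mulr_ge0 ?(ltW D_gt0)//.
by rewrite le_max sqr_ge0 orbT.
Qed.

Lemma proj_gain_eq0 q : q <= vth ^+ 2 -> proj_gain q = 0.
Proof. by move=> qv; rewrite /proj_gain max_l ?mul0r// subr_le0. Qed.

(* The correction term points inward with respect to the ball of radius [vth],
   which contains [ths]. *)
Lemma proj_ext_dot_le p y ths : enorm ths <= vth ->
  dot (p - ths) (proj_ext p y) <= gam * dot (p - ths) y.
Proof.
move=> ths_le; rewrite dotZr ler_pM2l// dotBr dotZr gerBl.
have [qv|qv] := leP (dot p p) (vth ^+ 2); first by rewrite proj_gain_eq0// !mul0r.
apply: mulr_ge0; first by rewrite mulr_ge0 ?proj_gain_ge0// le_max lexx.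
rewrite dotBl subr_ge0 (le_trans (dot_CauchySchwarz _ _))// -enorm_sqr expr2.
rewrite ler_wpM2r ?enorm_ge0// (le_trans ths_le)//.
by rewrite -ler_sqr ?nnegrE ?enorm_ge0 ?(ltW vth_gt0)// enorm_sqr ltW.
Qed.

(** Since [D = (vth + eps)^2 - vth^2], here [f p >= 1]: the correction removes at least the whole
    outward radial component. *)
Lemma proj_ext_radial_le0 p y : (vth + eps) ^+ 2 <= dot p p ->
  dot p (proj_ext p y) <= 0.
Proof.
move=> pq; rewrite dotZr pmulr_rle0// dotBr dotZr subr_le0.
have q0 : 0 < dot p p by rewrite (lt_le_trans _ pq)// exprn_gt0 ?addr_gt0.
have qv : vth ^+ 2 <= dot p p.
  by apply: le_trans pq; rewrite sqrrD -addrA lerDl addr_ge0 ?sqr_ge0// mulrn_wge0// mulr_ge0// ltW.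
have : 1 <= proj_gain (dot p p) * dot p p.
  rewrite /proj_gain max_r ?subr_ge0// max_l//.
  rewrite invfM mulrA divfK ?gt_eqF// ler_pdivlMr// mul1r /D.
  by move: pq; rewrite sqrrD -mulr_natl; lra.
move=> g1; rewrite mulrAC; apply: (@le_trans _ _ (Num.max 0 (dot p y))).
  by rewrite le_max lexx orbT.
by rewrite ler_peMl ?le_max ?lexx.
Qed.

Lemma coord_cvg_proj_ext (F : set_system R) {FF : Filter F} (z w : R -> 'cV[R]_n) p y :
  coord_cvg F z p -> coord_cvg F w y ->
  coord_cvg F (fun s => proj_ext (z s) (w s)) (proj_ext p y).
Proof.
move=> zp wy; apply: coord_cvgZ; first exact: cvg_cst.
apply: coord_cvgB => //; apply: coord_cvgZ => //.
have zz := cvg_dot zp zp.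
apply: cvgM; last by apply: cvg_maxr; [exact: cvg_cst|exact: cvg_dot].
apply: cvgM; first by apply: cvg_maxr; [exact: cvg_cst|apply: cvgB; [exact: zz|exact: cvg_cst]].
apply: cvgV; first by rewrite gt_eqF// mulr_gt0// lt_max orbC exprn_gt0.
by apply: cvgM; [exact: cvg_cst|apply: cvg_maxr; [exact: zz|exact: cvg_cst]].
Qed.
End ProjectionOperator.

(** * Regularity of Caratheodory solutions *)

Section CaratheodorySolutions.
Variables (R : realType) (n : nat).
Implicit Types (z w F G : R -> 'cV[R]_n) (T : \bar R) (t : R).

Lemma abs_continuous_onB a b z w : abs_continuous_on a b z -> abs_continuous_on a b w ->
  abs_continuous_on a b (fun t => z t - w t).
Proof.
move=> zac wac e e0; have e20 : 0 < e / 2 by rewrite divr_gt0.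
have [d1 d10 H1] := zac _ e20; have [d2 d20 H2] := wac _ e20.
exists (Num.min d1 d2); first by rewrite lt_min d10.
move=> k u v uv disj; rewrite lt_min => /andP[uv1 uv2].
apply: (@le_lt_trans _ _ (\sum_i enorm (z (v i) - z (u i)) +
                           \sum_i enorm (w (v i) - w (u i)))); last first.
  by rewrite [e]splitr ltrD ?H1 ?H2.
rewrite -big_split; apply: ler_sum => i _ /=.
have -> : z (v i) - w (v i) - (z (u i) - w (u i)) =
    (z (v i) - z (u i)) - (w (v i) - w (u i)).
  by rewrite !opprD !opprK addrACA.
by rewrite (le_trans (enormD _ _))// enormN.
Qed.

Lemma ode_solutionB T z w F G : ode_solution T z F -> ode_solution T w G ->
  ode_solution T (fun t => z t - w t) (fun t => F t - G t).
Proof.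
move=> [zac [A [mA A0 FA]]] [wac [B [mB B0 GB]]]; split.
  by move=> t t0 tT; apply: abs_continuous_onB; [exact: zac|exact: wac].
exists (A `|` B); split.
- exact: measurableU.
- by rewrite measureU0.
- move=> t /= H; apply: contrapT => /not_orP[At Bt]; apply: H => t0 tT.
  have zt : is_derive t (1 : R) z (F t).
    by apply: contrapT => h; apply: At; apply: FA => /= /(_ t0 tT).
  have wt : is_derive t (1 : R) w (G t).
    by apply: contrapT => h; apply: Bt; apply: GB => /= /(_ t0 tT).
  exact: is_deriveB.
Qed.

(** Absolute continuity is given on intervals [[0, t1]] with [t1 < T]; two-sided statements at [t]
    need such a [t1] beyond [t]. *)
Lemma ereal_lt_between t T : (t%:E < T)%E -> exists2 t1, t < t1 & (t1%:E < T)%E.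
Proof.
case: T => [T|_|//]; last by exists (t + 1); rewrite ?ltrDl// ltry.
by rewrite lte_fin => tT; exists ((t + T) / 2); rewrite ?lte_fin; lra.
Qed.

Lemma ode_solution_cvg T z F t : ode_solution T z F -> 0 < t -> (t%:E < T)%E ->
  coord_cvg (nbhs t) z (z t).
Proof.
move=> [zac _] t0 /ereal_lt_between[t1 tt1 t1T] i.
have /(abs_continuous_coord i)/abs_continuous_dist H := zac t1 (ltW (lt_trans t0 tt1)) t1T.
apply/cvgrPdist_lt => e e0; have [d d0 {}H] := H e e0.
exists (Num.min d (Num.min t (t1 - t))) => /=.
  by rewrite !lt_min d0 t0 subr_gt0.
move=> s; rewrite /= !lt_min => /and3P[sd st st1].
have [ts|ts] := leP t s.
  rewrite distrC; apply: H => //; first exact: ltW.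
    by move: st1; rewrite ltr_distl => /andP[]; lra.
  by rewrite ltr_distl in sd; move: sd => /andP[]; lra.
apply: H; [|exact: ltW|exact: ltW|].
  by move: st; rewrite ltr_distl => /andP[]; lra.
by move: sd; rewrite ltr_distl => /andP[]; lra.
Qed.

(** Nothing constrains [z] at negative times, so only the right limit is available at [0]. *)
Lemma ode_solution_cvg0 T z F : ode_solution T z F -> (0 < T)%E ->
  coord_cvg (0^'+) z (z 0).
Proof.
move=> [zac _] /ereal_lt_between[t1 t10 t1T] i.
have /(abs_continuous_coord i)/abs_continuous_dist H := zac t1 (ltW t10) t1T.
apply/cvgrPdist_lt => e e0; have [d d0 {}H] := H e e0.
exists (Num.min d t1) => /=; first by rewrite lt_min d0.
move=> s; rewrite /= sub0r normrN lt_min => /andP[sd st] s0.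
rewrite (gtr0_norm s0) in sd st.
by rewrite distrC; apply: H; rewrite ?subr0// ltW.
Qed.

Lemma ode_solution_coord_derive T z F : ode_solution T z F ->
  (forall t, 0 < t -> (t%:E < T)%E -> coord_cvg (nbhs t) F (F t)) ->
  forall t, 0 < t -> (t%:E < T)%E -> coord_derive t z (F t).
Proof.
move=> [zac [A [mA A0 FA]]] Fc t t0 tT i.
have [t1 tt1 t1T] := ereal_lt_between tT.
apply: (@abs_continuous_is_derive R (fun s => z s i 0) (fun s => F s i 0) 0 t1).
- by rewrite t0.
- apply: abs_continuous_coord; apply: zac => //; exact/ltW/(lt_trans t0).
- exists A; split => // s /= H; apply: FA => /= h; apply: H => /andP[s0 st1].
  apply: is_derive_coord; apply: h; first exact: ltW.
  by apply: lt_trans t1T; rewrite lte_fin.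
- exact: Fc.
Qed.
End CaratheodorySolutions.

(** * Invariance and decay from differential inequalities *)

Section DifferentialInequalities.
Variable R : realType.
Implicit Types (g h : R -> R) (s t : R) (T : \bar R).

Lemma is_derive_cvg g t d : is_derive t (1 : R) g d -> g s @[s --> t] --> g t.
Proof.
by move=> [gt _]; apply: differentiable_continuous; apply/derivable1_diffP.
Qed.

Lemma within_continuous0 g t : 0 < t -> g s @[s --> 0^'+] --> g 0 ->
  (forall s, 0 < s -> s <= t -> g u @[u --> (s : R)] --> g s) ->
  {within `[0, t], continuous g}.
Proof.
move=> t0 g0 gc; apply/continuous_within_itvP => //; split => //.
  by move=> s; rewrite in_itv/= => /andP[s0 st]; apply: gc => //; exact: ltW.
by apply: cvg_at_left_filter; exact: gc.
Qed.

(** Only points to the left of [t2] are compared, as [t2 = t1] is possible. The linearization error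
    is allowed half of the slope [k]. *)
Let max_first_le0 g t1 t2 k d : 0 < k -> 0 < t2 -> t2 <= t1 ->
  (forall t, 0 <= t -> t <= t1 -> g t - k * t <= g t2 - k * t2) ->
  is_derive t2 (1 : R) g d -> 0 < d.
Proof.
move=> k0 t20 t21 gmax /is_derive1P/(_ (k / 2)); rewrite divr_gt0// => /(_ isT)[rho rho0 H].
pose e := Num.min (rho / 2) t2.
have e0 : 0 < e by rewrite lt_min divr_gt0.
have [er et] : e <= rho / 2 /\ e <= t2 by rewrite /e !ge_min !lexx orbT.
have st : t2 - e - t2 = - e by ring.
have er' : e < rho by lra.
have := H (t2 - e); rewrite st normrN gtr0_norm// => /(_ er')/ler_normlP[h1 h2].
have h3 : g (t2 - e) - k * (t2 - e) <= g t2 - k * t2 by apply: gmax; lra.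
rewrite -(pmulr_lgt0 _ e0); have : 0 < k * e by rewrite mulr_gt0.
lra.
Qed.

(** The sign conditions concern only the larger function, so the maximum of the two is followed.
    They are not strict; subtracting a line of small positive slope supplies the strictness. *)
Lemma max_invariance g h dg dh c T :
  g s @[s --> 0^'+] --> g 0 -> h s @[s --> 0^'+] --> h 0 ->
  (forall t, 0 < t -> (t%:E < T)%E -> is_derive t (1 : R) g (dg t)) ->
  (forall t, 0 < t -> (t%:E < T)%E -> is_derive t (1 : R) h (dh t)) ->
  (forall t, c < g t -> h t <= g t -> dg t <= 0) ->
  (forall t, c < h t -> g t <= h t -> dh t <= 0) ->
  g 0 <= c -> h 0 <= c ->
  forall t, 0 <= t -> (t%:E < T)%E -> g t <= c /\ h t <= c.
Proof.
move=> g0 h0 dg_ dh_ gc hc gc0 hc0 t1 t10 t1T.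
pose W t := Num.max (g t) (h t).
suff : W t1 <= c by rewrite ge_max => /andP[].
rewrite leNgt; apply/negP => cW.
have {}t10 : 0 < t1.
  by rewrite lt_def t10 andbT; apply: contraTneq cW => ->; rewrite -leNgt ge_max gc0.
(* The tilt costs half of the excess at [t1], so the tilted maximum still exceeds [c] and cannot be
   attained at [0]. *)
pose k := (W t1 - c) / (2 * t1).
have k0 : 0 < k by rewrite divr_gt0 ?subr_gt0// mulr_gt0.
have kt1 : k * t1 = (W t1 - c) / 2 by rewrite /k; field; rewrite gt_eqF.
have ltT s : s <= t1 -> (s%:E < T)%E by move=> st; apply: le_lt_trans t1T; rewrite lee_fin.
have phic : {within `[0, t1], continuous (fun t => W t - k * t)}.
  have lin (F : set_system R) (FF : Filter F) (a : R) : id s @[s --> F] --> a ->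
      k * s @[s --> F] --> k * a.
    by move=> Fa; apply: cvgM => //; exact: cvg_cst.
  apply: within_continuous0 => //.
    apply: cvgB; first exact: cvg_maxr.
    by apply: lin; apply: cvg_at_right_filter; exact: cvg_id.
  move=> s s0 st; apply: cvgB; last by apply: lin; exact: cvg_id.
  by apply: cvg_maxr; apply: is_derive_cvg; [apply: dg_|apply: dh_] => //; exact: ltT.
have [t2] := EVT_max (ltW t10) phic.
rewrite in_itv/= => /andP[t20 t21] tmax.
have Wmax t : 0 <= t -> t <= t1 -> W t - k * t <= W t2 - k * t2.
  by move=> t0 tt; apply: tmax; rewrite in_itv/= t0.
have W1 := Wmax t1 (ltW t10) (lexx _).
have kt2 : 0 <= k * t2 by rewrite mulr_ge0// ltW.
have cW2 : c < W t2 by lra.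
have {}t20 : 0 < t2.
  by rewrite lt_def t20 andbT; apply: contraTneq cW2 => ->; rewrite -leNgt ge_max gc0.
have gW t : g t <= W t by rewrite le_max lexx.
have hW t : h t <= W t by rewrite le_max lexx orbT.
have [hg|gh] := leP (h t2) (g t2).
  have WE : W t2 = g t2 by rewrite /W max_l.
  have := gc t2; rewrite -WE => /(_ cW2); rewrite WE => /(_ hg); apply/negP; rewrite -ltNge.
  apply: (@max_first_le0 g t1 t2 k) => //; last by apply: dg_ => //; exact: ltT.
  move=> t t0 tt; rewrite -WE; apply: le_trans (Wmax t t0 tt); exact: lerB.
have WE : W t2 = h t2 by rewrite /W max_r// ltW.
have := hc t2; rewrite -WE => /(_ cW2); rewrite WE => /(_ (ltW gh)); apply/negP; rewrite -ltNge.
apply: (@max_first_le0 h t1 t2 k) => //; last by apply: dh_ => //; exact: ltT.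
move=> t t0 tt; rewrite -WE; apply: le_trans (Wmax t t0 tt); exact: lerB.
Qed.

(** Integrating factor: [expR (alpha * s) * (V s - beta / alpha)] is nonincreasing. A nonpositive
    term is dropped from the resulting bound. *)
Lemma gronwall_decay (V : R -> R) (alpha beta : R) T : 0 < alpha -> 0 <= beta ->
  V s @[s --> 0^'+] --> V 0 ->
  (forall t, 0 < t -> (t%:E < T)%E ->
    exists2 dV, is_derive t (1 : R) V dV & dV <= - alpha * V t + beta) ->
  forall t, 0 <= t -> (t%:E < T)%E -> V t <= expR (- alpha * t) * V 0 + beta / alpha.
Proof.
move=> al0 be0 V0 dV t; rewrite le_eqVlt => /predU1P[<- _|t0 tT].
  by rewrite mulr0 expR0 mul1r lerDl divr_ge0// ltW.
pose B := beta / alpha.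
pose W s := expR (alpha * s) * (V s - B).
have dW s : 0 < s -> (s%:E < T)%E -> exists2 d, is_derive s (1 : R) W d & d <= 0.
  move=> s0 sT; have [dv Vdv dvle] := dV s s0 sT.
  have dlin : is_derive s (1 : R) (fun u => alpha * u) alpha.
    by have := is_deriveZ alpha (is_derive_id s (1 : R)); rewrite /GRing.scale/= mulr1.
  have dexp : is_derive s (1 : R) (fun u => expR (alpha * u)) (alpha * expR (alpha * s)).
    have := @is_derive1_comp R expR (fun u => alpha * u) s _ _ (is_derive_expR _) dlin.
    by rewrite mulrC.
  have dVB : is_derive s (1 : R) (fun u => V u - B) (dv - 0).
    by apply: is_deriveB; exact: is_derive_cst.
  exists (expR (alpha * s) *: (dv - 0) + (V s - B) *: (alpha * expR (alpha * s))).
    exact: is_deriveM.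
  rewrite subr0 -[_ *: dv]/(_ * _) -[_ *: (_ * _)]/(_ * _).
  have -> : expR (alpha * s) * dv + (V s - B) * (alpha * expR (alpha * s)) =
    expR (alpha * s) * (dv + alpha * V s - beta).
    by rewrite /B; field; rewrite gt_eqF.
  by rewrite pmulr_rle0 ?expR_gt0//; lra.
have ltT s : s <= t -> (s%:E < T)%E by move=> st; apply: le_lt_trans tT; rewrite lee_fin.
have dWi s : s \in `]0, t[ -> exists2 d, is_derive s (1 : R) W d & d <= 0.
  by rewrite in_itv/= => /andP[s0 st]; apply: dW => //; apply: ltT; exact: ltW.
have : W t <= W 0.
  apply: (@ler0_derive1_le_cc R W 0 t); rewrite ?in_itv/= ?lexx ?(ltW t0)//.
  - by move=> s /dWi[d []].
  - by move=> s /dWi[d [_ <-]]; rewrite derive1E.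
  apply: within_continuous0 => //.
    apply: cvgM; last by apply: cvgB => //; exact: cvg_cst.
    apply: cvg_at_right_filter; apply: cvg_comp; last exact: continuous_expR.
    by apply: cvgM; [exact: cvg_cst|exact: cvg_id].
  by move=> s s0 st; have [d Wd _] := dW s s0 (ltT s st); exact: is_derive_cvg Wd.
rewrite /W mulr0 expR0 mul1r mulrC -ler_pdivlMr ?expR_gt0// -expRN -(mulNr alpha) => h.
have e0 := expR_gt0 (- alpha * t).
have B0 : 0 <= B by rewrite divr_ge0// ltW.
have : 0 <= B * expR (- alpha * t) by rewrite mulr_ge0// ltW.
rewrite -/B; lra.
Qed.
End DifferentialInequalities.

(** * Error equations, derivative of the Lyapunov function, parameter bounds *)

Section ErrorDynamics.
Variables (R : realType) (n : nat) (Ap Am Pm : 'M[R]_n) (b thstar : 'cV[R]_n).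
Variables (r : R -> R) (l gam eta eps vth sigma : R).
Variables (T : \bar R) (x xm xi th thh : R -> 'cV[R]_n).
Hypotheses (gam_gt0 : 0 < gam) (eta_gt0 : 0 < eta) (eps_gt0 : 0 < eps).
Hypotheses (vth_gt0 : 0 < vth) (T_gt0 : (0 < T)%E) (sl_gt0 : 0 < sigma + l).
Hypothesis matching : Am = Ap + b *m thstar^T.
Hypothesis thstar_le : enorm thstar <= vth.
Hypothesis Psym : Pm^T = Pm.
Hypothesis lyap : (Am - l%:M)^T *m Pm + Pm *m (Am - l%:M) = - 1%:M.
Let Pi : 'M[R]_n := (2 * (sigma + l))^-1%:M.
Hypothesis sol : cmrac_c_solution Ap Am Pm Pi gam%:M b r l sigma eta
  (@proj_fun R n vth eps) T x xm xi th thh.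

Let em t := x t - xm t.
Let ei t := xi t - x t.
Let proj := @proj_ext R n gam vth eps.

(** These four fields are the right-hand sides once [matching] has eliminated [Ap] and [r] has
    cancelled; what remains depends continuously on the values of the signals. *)
Let Fem t := (Am - l%:M) *m em t + dot (th t - thstar) (x t) *: b.
Let Fei t := - (sigma + l) *: ei t - dot (thh t - thstar) (x t) *: b.
Let Fth t := proj (th t) (- dot (Pm *m em t) b *: x t) - eta *: (th t - thh t).
Let Fthh t := proj (thh t) (dot (Pi *m ei t) b *: x t) + eta *: (th t - thh t).

Let outer_mulmx (p q : 'cV[R]_n) : b *m p^T *m q = dot p q *: b.
Proof.
rewrite -mulmxA (_ : p^T *m q = (dot p q)%:M) ?mul_mx_scalar//.
by apply/matrixP => i j; rewrite !ord1 [RHS]mxE eqxx mulr1n.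
Qed.

Let mulmx_qform (P : 'M[R]_n) (p q : 'cV[R]_n) : P^T = P ->
  p *m (q^T *m P *m b) = dot (P *m q) b *: p.
Proof.
move=> PT; rewrite (_ : q^T *m P *m b = (dot (P *m q) b)%:M) ?mul_mx_scalar//.
rewrite dot_mull PT /dot mulmxA.
by apply/matrixP => i j; rewrite !ord1 [RHS]mxE eqxx mulr1n.
Qed.

Let ode_em : ode_solution T em Fem.
Proof.
have [sx sxm _ _ _] := sol; have := ode_solutionB sx sxm.
congr (ode_solution _ _ _); apply/funext => t; rewrite /Fem /em mulmxBl.
have Amx : Am *m x t = Ap *m x t + dot thstar (x t) *: b.
  by rewrite matching mulmxDl outer_mulmx.
rewrite mulmxBr Amx mul_scalar_mx dotBl.
move: (Ap *m x t) (Am *m xm t) => p q; apply/colP => i; rewrite !mxE; ring.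
Qed.

Let ode_ei : ode_solution T ei Fei.
Proof.
have [sx _ sxi _ _] := sol; have := ode_solutionB sxi sx.
congr (ode_solution _ _ _); apply/funext => t; rewrite /Fei /ei mulmxBl.
rewrite matching mulmxDl !outer_mulmx dotBl.
move: (Ap *m x t) => p; apply/colP => i; rewrite !mxE; ring.
Qed.

Let ode_th : ode_solution T th Fth.
Proof.
have [_ _ _ + _] := sol.
congr (ode_solution _ _ _); apply/funext => t.
by rewrite ProjE// mulmx_qform// -scaleNr.
Qed.

Let ode_thh : ode_solution T thh Fthh.
Proof.
have [_ _ _ _ +] := sol.
congr (ode_solution _ _ _); apply/funext => t.
by rewrite ProjE// mulmx_qform// tr_scalar_mx.
Qed.

Section Filters.
Context (F : set_system R) {FF : Filter F} (t : R).
Hypotheses (xF : coord_cvg F x (x t)) (emF : coord_cvg F em (em t)).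
Hypotheses (eiF : coord_cvg F ei (ei t)) (thF : coord_cvg F th (th t)).
Hypothesis thhF : coord_cvg F thh (thh t).

Let thB p := coord_cvgB (thF) (@coord_cvg_cst R n F FF p).
Let thhB p := coord_cvgB (thhF) (@coord_cvg_cst R n F FF p).

Lemma error_fields_cvg : [/\ coord_cvg F Fem (Fem t), coord_cvg F Fei (Fei t),
  coord_cvg F Fth (Fth t) & coord_cvg F Fthh (Fthh t)].
Proof.
have bF := @coord_cvg_cst R n F FF b.
have dF : coord_cvg F (fun s => eta *: (th s - thh s)) (eta *: (th t - thh t)).
  by apply: coord_cvgZ; [exact: cvg_cst|exact: coord_cvgB].
split.
- apply: coord_cvgD; first exact: coord_cvg_mulmx.
  by apply: coord_cvgZ => //; exact: cvg_dot.
- apply: coord_cvgB; first by apply: coord_cvgZ => //; exact: cvg_cst.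
  by apply: coord_cvgZ => //; exact: cvg_dot.
- apply: coord_cvgB => //; apply: coord_cvg_proj_ext => //.
  apply: coord_cvgZ => //; apply: cvgN; apply: cvg_dot => //.
  exact: coord_cvg_mulmx.
- apply: coord_cvgD => //; apply: coord_cvg_proj_ext => //.
  apply: coord_cvgZ => //; apply: cvg_dot => //.
  exact: coord_cvg_mulmx.
Qed.

Lemma lyapunov_cvg :
  lyapunov Pm Pi gam%:M (em s, ei s, th s - thstar, thh s - thstar) @[s --> F] -->
  lyapunov Pm Pi gam%:M (em t, ei t, th t - thstar, thh t - thstar).
Proof.
have qF (P : 'M[R]_n) (z : R -> 'cV[R]_n) : coord_cvg F z (z t) ->
    qform P (z s) @[s --> F] --> qform P (z t).
  move=> zF; rewrite qformE; under eq_fun do rewrite qformE.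
  by apply: cvg_dot => //; exact: coord_cvg_mulmx.
rewrite /lyapunov/=; apply: cvgD; last exact: (qF _ (fun s => thh s - thstar) (@thhB thstar)).
apply: cvgD; last exact: (qF _ (fun s => th s - thstar) (@thB thstar)).
by apply: cvgD; exact: qF.
Qed.
End Filters.

Lemma error_coord_derive t : 0 < t -> (t%:E < T)%E ->
  [/\ coord_derive t em (Fem t), coord_derive t ei (Fei t),
      coord_derive t th (Fth t) & coord_derive t thh (Fthh t)].
Proof.
have [sx _ _ _ _] := sol.
have cF s : 0 < s -> (s%:E < T)%E -> [/\ coord_cvg (nbhs s) Fem (Fem s),
    coord_cvg (nbhs s) Fei (Fei s), coord_cvg (nbhs s) Fth (Fth s) &
    coord_cvg (nbhs s) Fthh (Fthh s)].
  move=> s0 sT; apply: error_fields_cvg.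
  - exact: ode_solution_cvg sx s0 sT.
  - exact: ode_solution_cvg ode_em s0 sT.
  - exact: ode_solution_cvg ode_ei s0 sT.
  - exact: ode_solution_cvg ode_th s0 sT.
  - exact: ode_solution_cvg ode_thh s0 sT.
move=> t0 tT; split.
- by apply: (ode_solution_coord_derive ode_em) => // s s0 sT; have [] := cF s s0 sT.
- by apply: (ode_solution_coord_derive ode_ei) => // s s0 sT; have [] := cF s s0 sT.
- by apply: (ode_solution_coord_derive ode_th) => // s s0 sT; have [] := cF s s0 sT.
- by apply: (ode_solution_coord_derive ode_thh) => // s s0 sT; have [] := cF s s0 sT.
Qed.

Lemma error_cvg0 : [/\ coord_cvg (0^'+) th (th 0), coord_cvg (0^'+) thh (thh 0) &
  lyapunov Pm Pi gam%:M (em s, ei s, th s - thstar, thh s - thstar) @[s --> 0^'+] -->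
  lyapunov Pm Pi gam%:M (em 0, ei 0, th 0 - thstar, thh 0 - thstar)].
Proof.
have th0 := ode_solution_cvg0 ode_th T_gt0.
have thh0 := ode_solution_cvg0 ode_thh T_gt0.
split => //; apply: lyapunov_cvg => //.
- exact: ode_solution_cvg0 ode_em T_gt0.
- exact: ode_solution_cvg0 ode_ei T_gt0.
Qed.

(** The adaptation laws are chosen so that the terms containing [x] cancel against those of the
    error equations, the projection only helping. The coupling contributes [- 2 eta / gam] times the
    squared distance between the two estimates. *)
Lemma lyapunov_is_derive t : 0 < t -> (t%:E < T)%E ->
  exists2 dV, is_derive t (1 : R) (fun s =>
      lyapunov Pm Pi gam%:M (em s, ei s, th s - thstar, thh s - thstar)) dV &
    dV <= - enorm (em t) ^+ 2 - enorm (ei t) ^+ 2.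
Proof.
move=> t0 tT; have [dem dei dth dthh] := error_coord_derive t0 tT.
have dtth := coord_deriveB dth (@coord_derive_cst R n t thstar).
have dbth := coord_deriveB dthh (@coord_derive_cst R n t thstar).
have Ginv : invmx (gam%:M : 'M[R]_n) = gam^-1%:M by exact: invmx_scalar.
eexists.
  apply: is_deriveD; last by apply: is_derive_qform dbth; rewrite Ginv tr_scalar_mx.
  apply: is_deriveD; last by apply: is_derive_qform dtth; rewrite Ginv tr_scalar_mx.
  apply: is_deriveD; first exact: is_derive_qform dem.
  by apply: is_derive_qform dei; rewrite tr_scalar_mx.
rewrite Ginv !subr0 !mul_scalar_mx !dotZl.
have h3 := lyapunov_dot Psym lyap (em t).
have : gam^-1 * dot (th t - thstar) (proj (th t) (- dot (Pm *m em t) b *: x t)) <=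
    - dot (Pm *m em t) b * dot (th t - thstar) (x t).
  rewrite ler_pdivrMl//; apply: le_trans (proj_ext_dot_le _ _ _ _ _ _) _ => //.
  by rewrite dotZr.
have : gam^-1 * dot (thh t - thstar) (proj (thh t) (dot (Pi *m ei t) b *: x t)) <=
    dot (Pi *m ei t) b * dot (thh t - thstar) (x t).
  rewrite ler_pdivrMl//; apply: le_trans (proj_ext_dot_le _ _ _ _ _ _) _ => //.
  by rewrite dotZr.
rewrite /Fem /Fei /Fth /Fthh.
move: (proj (th t) _) (proj (thh t) _) => p1 p2 h2 h1.
rewrite !(dotDr, dotNr) !dotZr.
have h4 : 0 <= dot (th t - thstar) (th t - thh t) - dot (thh t - thstar) (th t - thh t).
  by rewrite -dotBl opprB addrA subrK dot_ge0.
have h5 := enorm_sqr (ei t).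
rewrite /Pi mul_scalar_mx dotZl in h2 *; set c := (2 * (sigma + l))^-1 in h2 *.
(* The scaling of [Pi] is the one for which [ei] is dissipated at exactly its squared norm. *)
have hc : 2 * (c * ((sigma + l) * dot (ei t) (ei t))) = enorm (ei t) ^+ 2.
  by rewrite h5 /c; field; rewrite gt_eqF.
have {}h4 : 0 <= gam^-1 * (eta * (dot (th t - thstar) (th t - thh t) -
    dot (thh t - thstar) (th t - thh t))).
  by rewrite mulr_ge0 ?invr_ge0 ?(ltW gam_gt0)// mulr_ge0// ltW.
lra.
Qed.
(** Each estimate is pulled towards the other, so neither ball can be treated alone. For the
    estimate of larger norm, the coupling has no outward radial component and the projection none
    beyond the radius. *)
Lemma parameter_ball : enorm (th 0) <= vth + eps -> enorm (thh 0) <= vth + eps ->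
  forall t, 0 <= t -> (t%:E < T)%E ->
    enorm (th t) <= vth + eps /\ enorm (thh t) <= vth + eps.
Proof.
have ve0 : 0 <= vth + eps by rewrite addr_ge0 ?ltW.
have sqE p : (enorm p <= vth + eps) = (dot p p <= (vth + eps) ^+ 2).
  by rewrite -enorm_sqr ler_sqr// nnegrE ?enorm_ge0.
have [thc thhc _] := error_cvg0.
rewrite !sqE => th0 thh0 t t0 tT; rewrite !sqE.
have sym2 (p q : 'cV[R]_n) : 2 * dot p q <= dot p p + dot q q.
  by have := dot_ge0 (p - q); rewrite dotBl !dotBr (dotC q p); lra.
apply: (@max_invariance R (fun s => dot (th s) (th s)) (fun s => dot (thh s) (thh s))
  (fun s => dot (Fth s) (th s) + dot (th s) (Fth s))
  (fun s => dot (Fthh s) (thh s) + dot (thh s) (Fthh s)) _ T) => //.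
- exact: cvg_dot.
- exact: cvg_dot.
- by move=> s s0 sT; have [_ _ dth _] := error_coord_derive s0 sT; exact: is_derive_dot.
- by move=> s s0 sT; have [_ _ _ dthh] := error_coord_derive s0 sT; exact: is_derive_dot.
- move=> s cs hg; rewrite (dotC (Fth s)) /Fth dotBr dotZr dotBr.
  have h1 := proj_ext_radial_le0 gam_gt0 vth_gt0 eps_gt0
    (- dot (Pm *m em s) b *: x s) (ltW cs).
  have : 0 <= eta * (dot (th s) (th s) - dot (th s) (thh s)).
    by rewrite mulr_ge0 ?(ltW eta_gt0)//; have := sym2 (th s) (thh s); lra.
  by move: h1; rewrite -/proj; lra.
- move=> s cs hg; rewrite (dotC (Fthh s)) /Fthh dotDr dotZr dotBr.
  have h1 := proj_ext_radial_le0 gam_gt0 vth_gt0 eps_gt0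
    (dot (Pi *m ei s) b *: x s) (ltW cs).
  have : 0 <= eta * (dot (thh s) (thh s) - dot (thh s) (th s)).
    by rewrite mulr_ge0 ?(ltW eta_gt0)//; have := sym2 (thh s) (th s); lra.
  by move: h1; rewrite -/proj; lra.
Qed.
End ErrorDynamics.

(** * Distance to the attracting set *)

Section AttractingSet.
Variables (R : realType) (n : nat).
Implicit Types (u w : 'cV[R]_n).

(** Shrink [u] radially to the sphere of radius [B]; then [(|u| - B)^2 <= |u|^2 - B^2] because
    [B <= |u|]. *)
Lemma ball_approximation u (B2 d2 : R) : 0 <= B2 -> 0 <= d2 ->
  enorm u ^+ 2 <= B2 + d2 ->
  exists2 w, enorm w ^+ 2 <= B2 & enorm (u - w) ^+ 2 <= d2.
Proof.
move=> B0 d0 uBd; have [uB|Bu] := leP (enorm u ^+ 2) B2.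
  by exists u => //; rewrite subrr enorm0 expr0n.
pose B := Num.sqrt B2; have BE : B ^+ 2 = B2 by exact: sqr_sqrtr.
have B_ge0 : 0 <= B by exact: sqrtr_ge0.
have Blt : B < enorm u by rewrite -ltr_sqr ?nnegrE ?enorm_ge0// BE.
have u0 : 0 < enorm u by exact: le_lt_trans Blt.
exists ((B / enorm u) *: u).
  by rewrite enormZ ger0_norm ?divr_ge0 ?enorm_ge0// divfK ?gt_eqF// BE.
rewrite -{1}(scale1r u) -scalerBl enormZ ger0_norm; last first.
  by rewrite subr_ge0 ler_pdivrMr// mul1r ltW.
rewrite mulrBl mul1r divfK ?gt_eqF//.
have : 0 <= B * (enorm u - B) by rewrite mulr_ge0// subr_ge0 ltW.
by rewrite sqrrB -mulr_natl expr2 in BE uBd *; lra.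
Qed.

Lemma errors_set_dist_attracting (em ei tth bth : 'cV[R]_n) (b4 b5 th d4 d5 : R) :
  0 <= b4 -> 0 <= b5 -> 0 <= d4 -> 0 <= d5 ->
  enorm em ^+ 2 <= b4 * th ^+ 2 + d4 -> enorm ei ^+ 2 <= b5 * th ^+ 2 + d5 ->
  enorm tth <= th -> enorm bth <= th ->
  errors_set_dist (em, ei, tth, bth) (attracting_set b4 b5 th) <= Num.sqrt (d4 + d5).
Proof.
move=> b40 b50 d40 d50 hem hei htth hbth.
have [w4 w4b w4d] := ball_approximation (mulr_ge0 b40 (sqr_ge0 th)) d40 hem.
have [w5 w5b w5d] := ball_approximation (mulr_ge0 b50 (sqr_ge0 th)) d50 hei.
apply: (@le_trans _ _ (errors_dist (em, ei, tth, bth) (w4, w5, tth, bth))).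
  apply: ge_inf; last by exists (w4, w5, tth, bth).
  by exists 0 => _ [[[[z1 z2] z3] z4] _ <-]; exact: sqrtr_ge0.
rewrite /errors_dist !subrr enorm0 expr0n/= !addr0.
by apply: ler_wsqrtr; exact: lerD.
Qed.
End AttractingSet.

(** * Boundedness, decay of the Lyapunov function and exponential convergence *)

Theorem theorem15 (R : realType) (n : nat) (n_gt0 : (0 < n)%N)
    (Ap Am Pm : 'M[R]_n) (b thstar : 'cV[R]_n) (r : R -> R)
    (l gam eta eps thstar_max : R)
    (r_bounded : exists C : R, forall t : R, 0 <= t -> `|r t| <= C)
    (Am_hurwitz : hurwitz Am)
    (l_ge0 : 0 <= l) (gam_gt0 : 0 < gam) (eta_gt0 : 0 < eta)
    (eps_gt0 : 0 < eps) (thstar_max_gt0 : 0 < thstar_max)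
    (matching : Am = Ap + b *m thstar^T)
    (thstar_le : enorm thstar <= thstar_max)
    (Pm_posdef : posdef Pm)
    (Pm_lyap : (Am - l%:M)^T *m Pm + Pm *m (Am - l%:M) = - 1%:M) :
  let Gam : 'M[R]_n := gam%:M in
  let sigma : R := - spectral_abscissa Am in
  let s : R := - min_sym_eigenvalue Am in
  let a : R := opnorm Am in
  let m : R := (1 + 4 * a / sigma) ^+ n.-1 in
  let Pi : 'M[R]_n := (2 * (sigma + l))^-1%:M in
  let f := @proj_fun R n thstar_max eps in
  let thmax : R := thstar_max + eps in
  let tthmax : R := 2 * thstar_max + eps in
  let alpha1 : R := (sigma + 2 * l) / m ^+ 2 in
  let alpha2 : R := (sigma + 2 * l) / (m ^+ 2 * gam) * tthmax ^+ 2 in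
  let beta4 : R := 4 * (s + l) / gam in
  let beta5 : R := 4 * (sigma + l) / gam in
  forall em0 ei0 th0 thh0 : 'cV[R]_n,
  enorm th0 <= thmax -> enorm thh0 <= thmax ->
  (* the constants do not depend on T: no trajectory escapes in finite time,
     and T = +oo is the claim for all t >= 0 *)
  exists M K c : R, 0 < c /\
  forall (T : \bar R) (x xm xi th thh : R -> 'cV[R]_n), (0 < T)%E ->
  cmrac_c_solution Ap Am Pm Pi Gam b r l sigma eta f T x xm xi th thh ->
  x 0 - xm 0 = em0 -> xi 0 - x 0 = ei0 -> th 0 = th0 -> thh 0 = thh0 ->
  let z (t : R) : errors R n :=
    (x t - xm t, xi t - x t, th t - thstar, thh t - thstar) in
  let V (t : R) : R := lyapunov Pm Pi Gam (z t) in
  [/\ forall t : R, 0 <= t -> (t%:E < T)%E ->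
        [/\ enorm (x t - xm t) <= M, enorm (xi t - x t) <= M,
            enorm (th t) <= M & enorm (thh t) <= M],
      forall t : R, 0 < t -> (t%:E < T)%E ->
        derivable V t 1 /\ derive1 V t <= - alpha1 * V t + 2 * alpha2 &
      forall t : R, 0 <= t -> (t%:E < T)%E ->
        errors_set_dist (z t) (attracting_set beta4 beta5 tthmax)
          <= K * expR (- c * t)].
Proof.
move=> Gam sigma s a m Pi f thmax tthmax alpha1 alpha2 beta4 beta5.
move=> em0 ei0 th0 thh0 th0_le thh0_le.
have [Psym Ppos] := Pm_posdef.
have sigma0 : 0 < sigma by rewrite oppr_gt0 spectral_abscissa_lt0.
have sl0 : 0 < sigma + l by rewrite ltr_wpDr.
have s2l0 : 0 < sigma + 2 * l by rewrite ltr_wpDr ?mulr_ge0.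
have [s_l0 Plb] := lyapunov_qform_lb n_gt0 Psym Pm_lyap Ppos.
rewrite -/s in s_l0 Plb.
have m1 : 1 <= m ^+ 2.
  by rewrite !exprn_ege1// lerDl divr_ge0 ?(ltW sigma0)// mulr_ge0 ?opnorm_ge0.
have m0 : 0 < m ^+ 2 by exact: lt_le_trans ltr01 m1.
have Pub u : qform Pm u <= alpha1^-1 * enorm u ^+ 2.
  rewrite /alpha1 invf_div; exact: lyapunov_qform_ub.
have PiE u : qform Pi u = (2 * (sigma + l))^-1 * enorm u ^+ 2.
  by rewrite qformE mul_scalar_mx dotZr enorm_sqr.
have GE u : qform (invmx Gam) u = gam^-1 * enorm u ^+ 2.
  by rewrite invmx_scalar qformE mul_scalar_mx dotZr enorm_sqr.
have a10 : 0 < alpha1 by rewrite divr_gt0.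
(* The rate obtained from [Pm] also serves for [Pi]: [alpha1 <= sigma + 2 l <= 2 (sigma + l)], since
   [m >= 1]. *)
have Piub u : qform Pi u <= alpha1^-1 * enorm u ^+ 2.
  have sl20 : 0 < 2 * (sigma + l) by rewrite mulr_gt0.
  rewrite PiE ler_wpM2r ?sqr_ge0// lef_pV2 ?posrE//.
  rewrite /alpha1 ler_pdivrMr//.
  apply: (@le_trans _ _ (2 * (sigma + l))); first lra.
  by rewrite ler_peMr// ltW.
have tth0 : 0 < tthmax by rewrite addr_gt0 ?mulr_gt0.
have a2E : 2 * alpha2 = alpha1 * (2 * (gam^-1 * tthmax ^+ 2)).
  have mN0 : m != 0 by rewrite -sqrf_eq0 gt_eqF.
  by rewrite /alpha2 /alpha1; field; rewrite mN0 gt_eqF.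
have gtt0 : 0 <= gam^-1 * tthmax ^+ 2 by rewrite mulr_ge0 ?sqr_ge0// invr_ge0 ltW.
have a20 : 0 <= 2 * alpha2 by rewrite a2E mulr_ge0 ?(ltW a10)// mulr_ge0.
have b40 : 0 <= beta4 by rewrite divr_ge0 ?(ltW gam_gt0)// mulr_ge0// ltW.
have b50 : 0 <= beta5 by rewrite divr_ge0 ?(ltW gam_gt0)// mulr_ge0// ltW.
pose z0 : errors R n := (em0, ei0, th0 - thstar, thh0 - thstar).
pose V0 := lyapunov Pm Pi Gam z0.
have qPm u : 0 <= qform Pm u.
  have h : 0 < 2 * (s + l) by rewrite mulr_gt0.
  by rewrite -(pmulr_rge0 _ h); apply: le_trans (Plb u); exact: sqr_ge0.
have qPi u : 0 <= qform Pi u by rewrite PiE mulr_ge0 ?sqr_ge0// invr_ge0 mulr_ge0// ltW.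
have qG u : 0 <= qform (invmx Gam) u by rewrite GE mulr_ge0 ?sqr_ge0// invr_ge0 ltW.
have V00 : 0 <= V0 by rewrite !addr_ge0.
pose K4 := 2 * (s + l) * V0; pose K5 := 2 * (sigma + l) * V0.
have K40 : 0 <= K4 by rewrite mulr_ge0// mulr_ge0// ltW.
have K50 : 0 <= K5 by rewrite mulr_ge0// mulr_ge0// ltW.
(* [M] is a sum so that one constant dominates all four norms. The rate is halved because [alpha1]
   governs squared norms, whereas the distance is a square root. *)
exists (Num.sqrt (beta4 * tthmax ^+ 2 + K4) + Num.sqrt (beta5 * tthmax ^+ 2 + K5) + thmax),
  (Num.sqrt (K4 + K5)), (alpha1 / 2); split; first by rewrite divr_gt0.
move=> T x xm xi th thh T0 sol xE xiE thE thhE z V.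
have ball : forall t, 0 <= t -> (t%:E < T)%E -> enorm (th t) <= thmax /\ enorm (thh t) <= thmax.
  move=> t t0 tT; apply: (parameter_ball gam_gt0 eta_gt0 eps_gt0 thstar_max_gt0 T0
    matching Psym sol) => //; by rewrite ?thE ?thhE.
have tball : forall t, 0 <= t -> (t%:E < T)%E ->
    enorm (th t - thstar) <= tthmax /\ enorm (thh t - thstar) <= tthmax.
  move=> t t0 tT; have [h1 h2] := ball t t0 tT; split.
    apply: le_trans (enormD _ _) _; rewrite enormN.
    by move: h1 thstar_le; rewrite /tthmax /thmax; lra.
  apply: le_trans (enormD _ _) _; rewrite enormN.
  by move: h2 thstar_le; rewrite /tthmax /thmax; lra.
have dV : forall t, 0 < t -> (t%:E < T)%E ->
    exists2 d, is_derive t (1 : R) V d & d <= - alpha1 * V t + 2 * alpha2.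
  move=> t t0 tT; have [h1 h2] := tball t (ltW t0) tT.
  have [d Vd dle] := lyapunov_is_derive gam_gt0 eta_gt0 eps_gt0 thstar_max_gt0 sl0
    matching thstar_le Psym Pm_lyap sol t0 tT.
  exists d => //; apply: le_trans dle _ => /=.
  have sqle (u : 'cV[R]_n) : enorm u <= tthmax -> qform (invmx Gam) u <= gam^-1 * tthmax ^+ 2.
    move=> ule; rewrite GE ler_wpM2l ?invr_ge0 ?(ltW gam_gt0)//.
    by rewrite ler_sqr ?nnegrE ?enorm_ge0 ?(ltW tth0).
  (* Multiplied by [alpha1], this turns the dissipation of the two errors into decay of all of [V],
     up to the constant [2 * alpha2] coming from the parameter terms. *)
  have : V t <= alpha1^-1 * (enorm (x t - xm t) ^+ 2 + enorm (xi t - x t) ^+ 2) +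
      2 * (gam^-1 * tthmax ^+ 2).
    rewrite /V /z /lyapunov.
    have := Pub (x t - xm t); have := Piub (xi t - x t).
    by have := sqle _ h1; have := sqle _ h2; lra.
  rewrite -(ler_pM2l a10) [X in _ <= X -> _]mulrDr mulVKf ?gt_eqF// a2E; lra.
have Vt : forall t, 0 <= t -> (t%:E < T)%E ->
    V t <= expR (- alpha1 * t) * V0 + 2 * (gam^-1 * tthmax ^+ 2).
  have V0E : V 0 = V0 by rewrite /V /z xE xiE thE thhE.
  move=> t t0 tT; rewrite -V0E.
  have -> : 2 * (gam^-1 * tthmax ^+ 2) = 2 * alpha2 / alpha1.
    by rewrite a2E [RHS]mulrC mulKf ?gt_eqF.
  apply: (@gronwall_decay R V alpha1 (2 * alpha2) T) => //.
  by have [] := error_cvg0 gam_gt0 eps_gt0 thstar_max_gt0 T0 matching Psym sol.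
have err : forall t, 0 <= t -> (t%:E < T)%E ->
    enorm (x t - xm t) ^+ 2 <= beta4 * tthmax ^+ 2 + K4 * expR (- alpha1 * t) /\
    enorm (xi t - x t) ^+ 2 <= beta5 * tthmax ^+ 2 + K5 * expR (- alpha1 * t).
  move=> t t0 tT; have := Vt t t0 tT.
  have h1 := qPm (x t - xm t); have h2 := qPi (xi t - x t).
  have h3 := qG (th t - thstar); have h4 := qG (thh t - thstar).
  have -> : beta4 * tthmax ^+ 2 + K4 * expR (- alpha1 * t) =
    2 * (s + l) * (expR (- alpha1 * t) * V0 + 2 * (gam^-1 * tthmax ^+ 2)).
    by rewrite /beta4 /K4; ring.
  have -> : beta5 * tthmax ^+ 2 + K5 * expR (- alpha1 * t) =
    2 * (sigma + l) * (expR (- alpha1 * t) * V0 + 2 * (gam^-1 * tthmax ^+ 2)).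
    by rewrite /beta5 /K5; ring.
  rewrite /V /z /lyapunov => Vle; split.
    apply: le_trans (Plb _) _; rewrite ler_wpM2l ?mulr_ge0 ?(ltW s_l0)//; lra.
  rewrite -ler_pdivrMl ?mulr_gt0// -PiE; lra.
have e1 t : 0 <= t -> expR (- alpha1 * t) <= 1.
  by move=> t0; rewrite expR_le1 mulNr oppr_le0 mulr_ge0// ltW.
split=> t t0 tT.
- have [h1 h2] := err t t0 tT; have [h3 h4] := ball t t0 tT.
  have le4 : K4 * expR (- alpha1 * t) <= K4 by rewrite ler_piMr// e1.
  have le5 : K5 * expR (- alpha1 * t) <= K5 by rewrite ler_piMr// e1.
  have s4 := sqrtr_ge0 (beta4 * tthmax ^+ 2 + K4).
  have s5 := sqrtr_ge0 (beta5 * tthmax ^+ 2 + K5).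
  have thm0 : 0 <= thmax by rewrite addr_ge0// ltW.
  have q4 : enorm (x t - xm t) <= Num.sqrt (beta4 * tthmax ^+ 2 + K4).
    by rewrite -(ger0_norm (enorm_ge0 _)) -sqrtr_sqr ler_wsqrtr//; lra.
  have q5 : enorm (xi t - x t) <= Num.sqrt (beta5 * tthmax ^+ 2 + K5).
    by rewrite -(ger0_norm (enorm_ge0 _)) -sqrtr_sqr ler_wsqrtr//; lra.
  by split; lra.
- by have [d [Vd <-] dle] := dV t t0 tT; rewrite derive1E.
- have [h1 h2] := err t t0 tT; have [h3 h4] := tball t t0 tT.
  have E0 := ltW (expR_gt0 (- alpha1 * t)).
  apply: le_trans (errors_set_dist_attracting b40 b50 _ _ h1 h2 h3 h4) _.
  + exact: mulr_ge0.
  + exact: mulr_ge0.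
  rewrite -mulrDl sqrtrM ?addr_ge0// ler_wpM2l ?sqrtr_ge0//.
  have -> : - alpha1 * t = - (alpha1 / 2) * t + - (alpha1 / 2) * t by field.
  by rewrite expRD -expr2 sqrtr_sqr ger0_norm// expR_ge0.
Qed.
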